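(* Let $a\in(0,1)$ and let $k\ge 1$ be a fixed integer. For $m\in\mathbb{N}$ let $L^k_m(a)$ be the error of the best uniform approximation of $\operatorname{sgn}(x)$ on $[-1,-a]\cup[a,1]$ by functions of the form $f(x)=\frac{a_{-(2k-1)}}{x^{2k-1}}+\dots+a_{2m-1}x^{2m-1}$. Then the following limit exists and has the stated value: $$\lim_{m\to\infty}L^k_m(a)\left(\frac{1+a}{1-a}\right)^{m-\frac12}(2m-1)^{k+\frac12}=\frac{2}{\pi}\left(\frac{1-a^2}{2a}\right)^{k+\frac12}\Gamma\left(k+\frac12\right).$$
   Context: For $k,m\in\mathbb{N}=\{1,2,\dots\}$ and $a\in(0,1)$, $L^k_m(a)=\inf_f\sup_{|x|\in[a,1]}|\operatorname{sgn}(x)-f(x)|$, where $f$ ranges over all functions $f(x)=\sum_{j=-(2k-1)}^{2m-1}a_jx^j$ with real coefficients (rational functions whose only possible poles are at the origin, of order at most $2k-1$, and at infinity, of order at most $2m-1$). Equivalently, $L^k_m(a)=\inf_{\deg P\le 2(m+k-1)}\sup_{|x|\in[a,1]}\left|\frac{|x|^{2k-1}-P(x)}{x^{2k-1}}\right|$, the infimum being over polynomials $P$. $\Gamma$ is the Euler gamma function. *)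

(* Defs.v *)
From HB Require Import structures.
From mathcomp Require Import all_boot all_order all_algebra.
From mathcomp Require Import all_classical all_reals all_analysis.
Set Implicit Arguments.
Unset Strict Implicit.
Unset Printing Implicit Defensive.
Import Order.TTheory GRing.Theory Num.Theory.
Import numFieldNormedType.Exports.
Local Open Scope classical_set_scope.
Local Open Scope ring_scope.

(* The sum of c_j x^j for -(2k-1) <= j <= 2m-1 (with k, m >= 1): there are
   2m + 2k - 1 terms, and the i-th one has exponent j = i - (2k-1).  The
   coefficient family is indexed by the exponent; only its values in that
   range matter. *)
Definition laurent (R : realType) (k m : nat) (c : int -> R) (x : R) : R :=
  \sum_(0 <= i < (2 * m + 2 * k - 1)%N)
    c (i%:Z - (2 * k - 1)%N%:Z) * x ^ (i%:Z - (2 * k - 1)%N%:Z).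

(* For 0 < a < 1 the values |sgn x - f x| form a nonempty bounded set, so the
   real-valued sup is the true supremum. *)
Definition sgn_error (R : realType) (a : R) (f : R -> R) : R :=
  sup [set `|Num.sg x - f x| | x in [set x : R | a <= `|x| <= 1]].

(* L^k_m(a) *)
Definition best_error (R : realType) (k m : nat) (a : R) : R :=
  inf [set sgn_error a (laurent k m c) | c in [set: int -> R]].

(* Euler's integral, which is Gamma(s) for s > 0. *)
Definition Gamma (R : realType) (s : R) : R :=
  \int[@lebesgue_measure R]_(t in `]0, +oo[) (t `^ (s - 1) * expR (- t)).

(* Main.v *)
Require Import Defs.
From HB Require Import structures.
From mathcomp Require Import all_boot all_order all_algebra.
From mathcomp Require Import all_classical all_reals all_analysis.
From mathcomp Require Import ring lra zify.
From mathcomp Require Import measurable_realfun.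
From mathcomp Require qpoly.
Set Implicit Arguments.
Unset Strict Implicit.
Unset Printing Implicit Defensive.
Import Order.TTheory GRing.Theory Num.Theory.
Import numFieldNormedType.Exports.
Local Open Scope classical_set_scope.
Local Open Scope ring_scope.

(** Only the odd part of f matters, and it is x^(1-2k) q(x^2) with q a
    polynomial of degree less than N = m + k.  The task is therefore to approximate
    x^(2k-1) on [a, 1] by q(x^2) with small relative error, and the proof
    exhibits a q that is optimal up to a factor 1 + o(1): the polynomial that
    interpolates at the zeros of a polynomial W of degree N for which
    x^(-2k-1) W(x^2) takes its extreme values N + 1 times with alternating
    signs.

    Put r = (1 - a)/(1 + a) and x^2 = ((1 + a)/2)^2 (1 + r z)(1 + r/z).  Then
    [a^2, 1] is the image of the unit circle, on which x is proportional to
    |1 + r z|, and W is the sum of z^N (1 + r/z)^(2k+1) and of its image under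
    z |-> 1/z (node_poly).  On the circle W is 2 |1 + r z|^(2k+1) times the
    cosine of a phase that goes from 0 to N pi (node_poly_alternation).

    Since the integral of 1/(w^2 + x^2) over w > 0 is pi/(2x), the remainder
    x^(2k-1) - q(x^2) is W(x^2) times an integral of t^k/(W(-t)(t + x^2)), where
    t is a multiple of w^2 (interpolation_error).  For t >= 0 the point - t
    comes from z = - s with s >= 1/r, where r^N |W| grows like (r s)^N
    (node_poly_negative_axis).  The mass thus concentrates at t of order 1/N, so
    that 1/(t + x^2) may be replaced by 1/x^2: the relative remainder is a
    constant times the equioscillating function, up to a factor 1 + o(1).  This
    bounds the best error from above directly (best_error_le), and from below
    by counting sign changes (le_best_error).

    With t = a w^2/N the functions r^N |W(-t)| tend to
    exp(w^2) (1 - r^2)^(2k+1), and the reciprocals times w^(2k) are dominated,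
    so the integrals converge to those of w^(2k) exp(-w^2), which produce
    Gamma(k + 1/2)/2 (integral_moment_growth_cvg, Gamma_half).  What remains is
    to collect the powers of r, N and a (amplitude_normalization,
    limit_constant). *)

(** * Chebyshev polynomials with a weight *)

Section WeightedChebyshev.
Variable R : realType.
Implicit Types (c : {poly R}) (r t x z : R) (L N : nat).

(** These are twice the Chebyshev polynomials of c / 2: at a point where c is
    z + 1/z the value is z^N + z^(-N). *)
Fixpoint chebyshev c N : {poly R} :=
  match N with
  | 0 => 2%:P
  | 1 => c
  | N'.+1 as N1.+1 => c * chebyshev c N1 - chebyshev c N1.-1
  end.

(** For L <= N this is z^N (1 + r/z)^L plus its image under z |-> 1/z, again as
    a polynomial in z + 1/z; multiplying the first summand by 1 + r/z amounts to
    adding r times the polynomial of index N - 1. *)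
Fixpoint wchebyshev c r L N : {poly R} :=
  if L is L'.+1 then wchebyshev c r L' N + r *: wchebyshev c r L' N.-1
  else chebyshev c N.

Lemma chebyshevSS c N :
  chebyshev c N.+2 = c * chebyshev c N.+1 - chebyshev c N.
Proof. by []. Qed.

Lemma chebyshev_ind (P : nat -> Prop) :
  P 0%N -> P 1%N -> (forall n, P n -> P n.+1 -> P n.+2) -> forall n, P n.
Proof.
move=> P0 P1 PS n; suff: P n /\ P n.+1 by case.
by elim: n => [|n [Pn PSn]]; split => //; apply: PS.
Qed.

Lemma size_chebyshev c N : (size c <= 2)%N -> (size (chebyshev c N) <= N.+1)%N.
Proof.
move=> c2; elim/chebyshev_ind: N => [|//|N IH0 IH1].
  by rewrite /= size_polyC leq_b1.
rewrite chebyshevSS (leq_trans (size_polyD _ _))// size_polyN geq_max.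
apply/andP; split; last by apply: leq_trans IH0 _; lia.
rewrite (leq_trans (size_polyMleq _ _))// -subn1 leq_subLR.
by rewrite (leq_trans (leq_add c2 IH1)).
Qed.

Lemma size_wchebyshev c r L N : (size c <= 2)%N ->
  (size (wchebyshev c r L N) <= N.+1)%N.
Proof.
move=> c2; elim: L N => [|L IH] N /=; first exact: size_chebyshev.
rewrite (leq_trans (size_polyD _ _))// geq_max IH/=.
rewrite (leq_trans (size_scale_leq _ _))// (leq_trans (IH _))//.
by rewrite ltnS leq_pred.
Qed.

Lemma chebyshev_joukowski c x z N : z != 0 -> c.[x] = z + z^-1 ->
  (chebyshev c N).[x] = z ^+ N + z ^- N.
Proof.
move=> z0 cx; elim/chebyshev_ind: N => [||N IH0 IH1].
- by rewrite /= hornerC expr0 invr1.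
- by rewrite /= cx expr1.
- by rewrite chebyshevSS hornerD hornerN hornerM IH0 IH1 cx !exprS; field;
    rewrite expf_neq0//= z0.
Qed.

Lemma wchebyshev_joukowski c r x z L N : z != 0 -> c.[x] = z + z^-1 ->
  (L <= N)%N ->
  (wchebyshev c r L N).[x]
    = z ^+ N * (1 + r / z) ^+ L + z ^- N * (1 + r * z) ^+ L.
Proof.
move=> z0 cx; elim: L N => [|L IH] N LN /=.
  by rewrite !expr0 !mulr1; exact: chebyshev_joukowski.
rewrite hornerD hornerZ IH; last exact: ltnW.
case: N LN => // N LN; rewrite IH//= !exprS; field.
by rewrite expf_neq0//= z0.
Qed.

Lemma chebyshev_cos c x t N : c.[x] = 2 * cos t ->
  (chebyshev c N).[x] = 2 * cos (N%:R * t).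
Proof.
move=> cx; elim/chebyshev_ind: N => [||N IH0 IH1].
- by rewrite /= hornerC mul0r cos0 mulr1.
- by rewrite /= cx mul1r.
- rewrite chebyshevSS hornerD hornerN hornerM IH0 IH1 cx.
  have -> : N.+2%:R * t = N.+1%:R * t + t by rewrite -natr1; ring.
  have -> : N%:R * t = N.+1%:R * t - t by rewrite -natr1; ring.
  by rewrite cosB cosD; ring.
Qed.

(** On the unit circle the two summands of wchebyshev are conjugate.  Writing
    1 + r exp(it) in polar form turns their sum into a cosine whose amplitude
    does not depend on N; this is what makes the weighted polynomial
    equioscillate. *)
Lemma wchebyshev_cos c r x t rho phi L N : c.[x] = 2 * cos t ->
  rho * cos phi = 1 + r * cos t -> rho * sin phi = r * sin t -> (L <= N)%N ->
  (wchebyshev c r L N).[x] = 2 * rho ^+ L * cos (N%:R * t - L%:R * phi).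
Proof.
move=> cx ccos csin; elim: L N => [|L IH] N LN /=.
  by rewrite expr0 mulr1 mul0r subr0; exact: chebyshev_cos.
rewrite hornerD hornerZ IH; last exact: ltnW.
case: N LN => // N LN; rewrite IH//=.
set A := N.+1%:R * t - L%:R * phi.
have -> : N%:R * t - L%:R * phi = A - t by rewrite /A -natr1; ring.
have -> : N.+1%:R * t - L.+1%:R * phi = A - phi.
  by rewrite /A -[L.+1%:R]natr1; ring.
clearbody A; rewrite !cosB exprS.
transitivity (2 * rho ^+ L *
  (cos A * (1 + r * cos t) + sin A * (r * sin t))); first by ring.
by rewrite -ccos -csin; ring.
Qed.

End WeightedChebyshev.

(** * The node polynomial and its alternation on [a, 1] *)

Section Alternance.
Variable R : realType.
Implicit Types (a x t s : R) (L N : nat).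

Lemma polar_atan (u v rho : R) : 0 < u -> 0 < rho ->
  rho ^+ 2 = u ^+ 2 + v ^+ 2 ->
  rho * cos (atan (v / u)) = u /\ rho * sin (atan (v / u)) = v.
Proof.
move=> u0 rho0 E.
have ccos : rho * cos (atan (v / u)) = u.
  rewrite cos_atan; have -> : 1 + (v / u) ^+ 2 = (rho / u) ^+ 2.
    by rewrite !expr_div_n E; field; rewrite gt_eqF.
  by rewrite sqrtr_sqr ger0_norm ?divr_ge0 ?ltW// invf_div mulrC divfK ?gt_eqF.
split=> //.
have c0 : cos (atan (v / u)) != 0.
  by apply/eqP => c0; move: ccos u0; rewrite c0 mulr0 => <-; rewrite ltxx.
have := atanK (v / u); rewrite /tan => /(canRL (divfK c0)) ->.
by rewrite mulrCA ccos divfK ?gt_eqF.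
Qed.

(** The points are found one after the other by the intermediate value theorem
    on the interval from the previous point to b, so f need not be monotone. *)
Lemma increasing_level_points (f : R -> R) (b v : R) (n : nat) :
  0 <= b -> 0 < v -> {within `[0, b], continuous f} ->
  f 0 = 0 -> f b = n%:R * v ->
  exists t : nat -> R,
    (forall j, (j <= n)%N -> 0 <= t j <= b /\ f (t j) = j%:R * v) /\
    (forall j, (j < n)%N -> t j < t j.+1).
Proof.
move=> b0 v0 cf f0 fb.
suff H : forall i, (i <= n)%N -> exists t : nat -> R,
    (forall j, (j <= i)%N -> 0 <= t j <= b /\ f (t j) = j%:R * v) /\
    (forall j, (j < i)%N -> t j < t j.+1) by exact: H.
elim=> [_|i IH iN].
  exists (fun=> 0); split=> // j; rewrite leqn0 => /eqP ->.
  by rewrite lexx b0 f0 mul0r.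
have [t [tP tS]] := IH (ltnW iN).
have [/andP[ti0 tib] fti] := tP i (leqnn i).
have ctb : {within `[t i, b], continuous f}.
  by apply: continuous_subspaceW cf; apply: subset_itvr; rewrite bnd_simp.
have [|c /[!in_itv]/= /andP[tic cb] fc] :=
    @IVT _ f (t i) b (i.+1%:R * v) tib ctb.
  by rewrite fti fb min_l ?max_r ?ler_wpM2r ?ler_nat ?ltW// ltnW.
exists (fun j => if (j <= i)%N then t j else c); split=> j ji.
  case: ifP => [|/negbT]; first exact: tP.
  rewrite -ltnNge => ij; have -> : j = i.+1 by apply/eqP; rewrite eqn_leq ji.
  by rewrite cb (le_trans ti0 tic).
have ji' : (j <= i)%N by [].
rewrite ji'; case: ifP => ji1; first exact: tS.
have -> : j = i by apply/eqP; rewrite eqn_leq ji' leqNgt ji1.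
rewrite lt_neqAle tic andbT; apply/eqP => tc.
move: fc; rewrite -tc fti => /(mulIf (lt0r_neq0 v0))/eqP.
by rewrite eqr_nat; lia.
Qed.

(** The number r such that z |-> ((1 + a)/2)^2 (1 + r z)(1 + r/z) maps the unit
    circle onto [a^2, 1].  The errors decay like r^N because the preimages of
    the branch point 0 are - r and - 1/r. *)
Definition rate a : R := (1 - a) / (1 + a).

(** The affine map that recovers z + 1/z from the point
    ((1 + a)/2)^2 (1 + r z)(1 + r/z). *)
Definition to_joukowski a : {poly R} :=
  (4 / (1 - a ^+ 2)) *: 'X - (2 * (1 + a ^+ 2) / (1 - a ^+ 2))%:P.

Definition node_poly a L N : {poly R} :=
  wchebyshev (to_joukowski a) (rate a) L N.

Lemma size_node_poly a L N : (size (node_poly a L N) <= N.+1)%N.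
Proof.
apply: size_wchebyshev; rewrite (leq_trans (size_polyD _ _))// geq_max.
rewrite (leq_trans (size_scale_leq _ _)) ?size_polyX//=.
by rewrite size_polyN (leq_trans (size_polyC_leq1 _)).
Qed.

Lemma horner_to_joukowski a x : (to_joukowski a).[x] =
  4 / (1 - a ^+ 2) * x - 2 * (1 + a ^+ 2) / (1 - a ^+ 2).
Proof. by rewrite /to_joukowski !hornerE. Qed.

(** The argument of z^N (1 + r/z)^L at z = exp(it). *)
Definition phase a L N (t : R) : R :=
  N%:R * t - L%:R * atan (rate a * sin t / (1 + rate a * cos t)).

Section Circle.
Variables (a : R) (ha : 0 < a < 1).

Lemma rate_gt0 : 0 < rate a.
Proof.
by have /andP[a0 a1] := ha; rewrite /rate divr_gt0 ?subr_gt0// addr_gt0.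
Qed.

Lemma rate_lt1 : rate a < 1.
Proof. by have /andP[a0 a1] := ha; rewrite /rate ltr_pdivrMr; lra. Qed.

Lemma one_add_rate_cos_gt0 t : 0 < 1 + rate a * cos t.
Proof.
have := cos_geN1 t; have := cos_le1 t; have := rate_gt0; have := rate_lt1.
by nra.
Qed.

Lemma node_poly_circle x t L N : 0 < x ->
  x ^+ 2 = (1 + a ^+ 2) / 2 + (1 - a ^+ 2) / 2 * cos t -> (L <= N)%N ->
  (node_poly a L N).[x ^+ 2] = 2 * (2 * x / (1 + a)) ^+ L * cos (phase a L N t).
Proof.
have /andP[a0 a1] := ha; have D0 : 0 < 1 - a ^+ 2 by nra.
move=> x0 xt LN.
have r0 : 0 < 2 * x / (1 + a) by rewrite divr_gt0 ?mulr_gt0//; lra.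
have [||] := @polar_atan (1 + rate a * cos t) (rate a * sin t) _ _ r0.
- exact: one_add_rate_cos_gt0.
- rewrite exprMn exprMn xt /rate exprMn sin2cos2; field.
  by rewrite gt_eqF//; lra.
move=> Hc Hs; apply: wchebyshev_cos => //.
rewrite horner_to_joukowski xt; field.
by rewrite gt_eqF//; lra.
Qed.

Lemma node_poly_le x L N : a <= x <= 1 -> (L <= N)%N ->
  `|(node_poly a L N).[x ^+ 2]| <= 2 * (2 * x / (1 + a)) ^+ L.
Proof.
have /andP[a0 a1] := ha; have D0 : 0 < 1 - a ^+ 2 by nra.
move=> /andP[ax x1] LN; have x0 : 0 < x by lra.
pose v := (2 * x ^+ 2 - (1 + a ^+ 2)) / (1 - a ^+ 2).
have v11 : -1 <= v <= 1.
  by rewrite /v ler_pdivlMr// ler_pdivrMr//; apply/andP; split; nra.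
rewrite (@node_poly_circle x (acos v))// ?acosK ?in_itv//; last first.
  by rewrite /v; field; lra.
have p0 : 0 <= 2 * (2 * x / (1 + a)) ^+ L.
  by rewrite mulr_ge0// exprn_ge0// divr_ge0; lra.
by rewrite normrM (ger0_norm p0) ler_piMr// cos_max.
Qed.

Lemma continuous_phase L N : continuous (phase a L N).
Proof.
move=> t; apply: cvgB; apply: cvgM; try exact: cvg_cst; first exact: cvg_id.
apply: continuous_comp; last exact: continuous_atan.
apply: cvgM.
  by apply: cvgM; [exact: cvg_cst|exact: continuous_sin].
apply: cvgV; first by rewrite gt_eqF// one_add_rate_cos_gt0.
apply: cvgD; first exact: cvg_cst.
by apply: cvgM; [exact: cvg_cst|exact: continuous_cos].
Qed.

Lemma cos_natpi n : cos (n%:R * pi) = (-1) ^+ n :> R.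
Proof.
elim: n => [|n IH]; first by rewrite mul0r cos0.
by rewrite -natr1 mulrDl mul1r cosDpi IH exprS mulN1r.
Qed.

(** The phase runs from 0 at t = 0 to N pi at t = pi, and the node polynomial
    attains its weighted extrema where the phase is a multiple of pi. *)
Lemma node_poly_alternation L N : (L <= N)%N ->
  exists X : nat -> R,
    [/\ forall j, (j <= N)%N -> a <= X j <= 1,
        forall j, (j < N)%N -> X j.+1 < X j &
        forall j, (j <= N)%N -> (node_poly a L N).[X j ^+ 2] =
          (-1) ^+ j * (2 * (2 * X j / (1 + a)) ^+ L)].
Proof.
have /andP[a0 a1] := ha; have D0 : 0 < 1 - a ^+ 2 by nra.
move=> LN.
have ph0 : phase a L N 0 = 0.
  by rewrite /phase sin0 !mulr0 mul0r atan0 mulr0 subrr.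
have phpi : phase a L N pi = N%:R * pi.
  by rewrite /phase sinpi !mulr0 mul0r atan0 mulr0 subr0.
have [t [tP tS]] := increasing_level_points (pi_ge0 R) (pi_gt0 R)
  (continuous_subspaceT (@continuous_phase L N)) ph0 phpi.
pose y s := (1 + a ^+ 2) / 2 + (1 - a ^+ 2) / 2 * cos s.
have yb s : a ^+ 2 <= y s <= 1.
  by have := cos_geN1 s; have := cos_le1 s; rewrite /y; nra.
have y0 s : 0 <= y s by have := yb s; nra.
exists (fun j => Num.sqrt (y (t j))); split=> j jN.
- have /andP[y1 y2] := yb (t j).
  have /ler_wsqrtr := y1; rewrite sqrtr_sqr gtr0_norm// => ->/=.
  by have := ler_wsqrtr y2; rewrite sqrtr1.
- have [? _] := tP _ (ltnW jN); have [? _] := tP _ jN.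
  rewrite ltr_sqrt; last by have := yb (t j); nra.
  rewrite /y ltrD2l ltr_pM2l ?ltr_cos ?in_itv//; first exact: tS.
  by rewrite divr_gt0.
- have [_ pht] := tP _ jN.
  rewrite (@node_poly_circle _ (t j))//.
  + by rewrite pht cos_natpi mulrC.
  + by rewrite sqrtr_gt0; have := yb (t j); nra.
  + by rewrite sqr_sqrtr.
Qed.

End Circle.
End Alternance.

(** * An integral formula for the interpolation error *)

Section CauchyKernel.
Variable R : realType.
Local Notation mu := (@lebesgue_measure R).
Local Notation D := (`[0, +oo[%classic : set R).

Lemma continuous_Cauchy (e x : R) : 0 < x ->
  continuous (fun w : R => ((e * w) ^+ 2 + x ^+ 2)^-1).
Proof.
move=> x0 w; apply: cvgV.
  by rewrite gt_eqF// ltr_wpDl ?sqr_ge0 ?exprn_gt0.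
apply: cvgD; last exact: cvg_cst.
rewrite expr2; under eq_fun do rewrite expr2.
by apply: cvgM; apply: cvgM; (exact: cvg_cst || exact: cvg_id).
Qed.

Lemma Cauchy_integral (e x : R) : 0 < e -> 0 < x ->
  (\int[mu]_(w in D) (((e * w) ^+ 2 + x ^+ 2)^-1)%:E = (pi / (2 * e * x))%:E)%E.
Proof.
move=> e0 x0.
have den0 w : 0 < (e * w) ^+ 2 + x ^+ 2.
  by rewrite ltr_wpDl ?sqr_ge0 ?exprn_gt0.
pose F (w : R) : R := (e * x)^-1 * atan (e / x * w).
have dF (w : R) : is_derive w (1 : R) F (((e * w) ^+ 2 + x ^+ 2)^-1).
  have -> : ((e * w) ^+ 2 + x ^+ 2)^-1 =
      (e * x)^-1 *: ((1 + (e / x * w) ^+ 2)^-1 * ((e / x) *: (1 : R))).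
    rewrite /GRing.scale/=; field.
    have := den0 w; rewrite exprMn => d0; rewrite !gt_eqF//.
    by rewrite addrC.
  have H1 : is_derive w (1 : R) (fun w : R => e / x * w) ((e / x) *: (1 : R)).
    exact: (@is_deriveZ _ _ _ (id : R -> R) (e / x) w 1 1).
  have H2 := @is_derive1_comp _ atan _ _ _ _ (is_derive1_atan (e / x * w)) H1.
  exact: (is_deriveZ _ H2).
rewrite (@ge0_continuous_FTC2y _ _ F 0 (pi / (2 * e * x))).
- by rewrite /F mulr0 atan0 mulr0 sube0.
- by move=> w _; rewrite invr_ge0 ltW.
- exact/continuous_subspaceT/continuous_Cauchy.
- have -> : pi / (2 * e * x) = (e * x)^-1 * (pi / 2).
    by field; rewrite !gt_eqF.
  apply: cvgM; first exact: cvg_cst.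
  have ex0 : 0 < e / x by rewrite divr_gt0.
  apply: (@cvg_comp _ _ _ ( *%R (e / x)) atan _ _ _ _ (@cvgy_atan R)).
  exact: gt0_cvgMry.
- by move=> w _; apply: ex_derive.
- apply: cvg_at_right_filter; apply: differentiable_continuous.
  by apply/derivable1_diffP; apply: ex_derive.
- by move=> w _; rewrite derive1E; apply: derive_val.
Qed.


Lemma measurable_half_line :
  measurable (D : set (g_sigma_algebraType R.-ocitv.-measurable)).
Proof. exact: measurable_itv. Qed.

Lemma continuous_measurable_half_line (f : R -> R) :
  continuous f -> measurable_fun D f.
Proof.
move=> cf; apply: (measurable_funS measurableT) => //.
exact: continuous_measurable_fun.
Qed.

Lemma integrable_Cauchy (e x : R) : 0 < e -> 0 < x ->
  mu.-integrable D (EFin \o (fun w => ((e * w) ^+ 2 + x ^+ 2)^-1)).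
Proof.
move=> e0 x0; apply/integrableP; split.
  apply/measurable_EFinP; apply: continuous_measurable_half_line.
  exact: continuous_Cauchy.
rewrite [ltLHS](_ : _ = (pi / (2 * e * x))%:E) ?ltry// -(Cauchy_integral e0 x0).
apply: eq_integral => w _ /=.
by rewrite ger0_norm// invr_ge0 addr_ge0 ?sqr_ge0.
Qed.

Lemma integrable_le_Cauchy (f : R -> R) (K e x : R) : 0 < e -> 0 < x ->
  continuous f ->
  (forall w, 0 <= w -> `|f w| <= K * ((e * w) ^+ 2 + x ^+ 2)^-1) ->
  mu.-integrable D (EFin \o f).
Proof.
move=> e0 x0 cf fK.
have H := integrableZl measurable_half_line K (integrable_Cauchy e0 x0).
apply: (le_integrable measurable_half_line _ _ H).
  by apply/measurable_EFinP; apply: continuous_measurable_half_line.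
move=> w; rewrite /= in_itv/= andbT => w0.
by rewrite lee_fin (le_trans (fK w w0))// ler_norm.
Qed.

Lemma Rintegral_sum (n : nat) (f : 'I_n -> R -> R) (l : 'I_n -> R) :
  (forall i, mu.-integrable D (EFin \o f i)) ->
  \int[mu]_(w in D) (\sum_(i < n) f i w * l i) =
  \sum_(i < n) (\int[mu]_(w in D) f i w) * l i.
Proof.
move=> fi; have mD := measurable_half_line.
have fli i : mu.-integrable D (EFin \o (fun w => f i w * l i)).
  by have := integrableZr mD (l i) (fi i).
rewrite /Rintegral; under eq_integral do rewrite -sumEFin.
rewrite integral_sum//= -sum_fine => [|i _]; last first.
  exact: (integrable_fin_num mD (fli i)).
by apply: eq_bigr => i _; rewrite -[LHS]/(Rintegral _ _ _) RintegralZr.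
Qed.

(** The part of y^k / (t + y) that is a polynomial in y once the multiple
    (-t)^k W(y) / (W(-t) (t + y)) of W, which has the same polar part at
    y = - t, is subtracted. *)
Definition interp_kernel (W : {poly R}) (k : nat) (t : R) : {poly R} :=
  W.[- t]^-1 *: (('X^k * W.[- t]%:P - (- t) ^+ k *: W) %/ ('X - (- t)%:P)).

Lemma size_interp_kernel (W : {poly R}) k t N :
  (k < N)%N -> (size W <= N.+1)%N ->
  (size (interp_kernel W k t) <= N)%N.
Proof.
move=> kN sW; rewrite (leq_trans (size_scale_leq _ _))//.
rewrite size_divp ?polyXsubC_eq0// size_XsubC leq_subLR add1n.
rewrite (leq_trans (size_polyD _ _))// geq_max size_polyN.
rewrite (leq_trans (size_scale_leq _ _))// andbT.
rewrite mulrC mul_polyC (leq_trans (size_scale_leq _ _))// size_polyXn.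
exact: ltnW.
Qed.

Lemma horner_interp_kernel (W : {poly R}) k t y : W.[- t] != 0 -> t + y != 0 ->
  (interp_kernel W k t).[y] =
  y ^+ k * (t + y)^-1 - (- 1) ^+ k * W.[y] * (t ^+ k / W.[- t] * (t + y)^-1).
Proof.
move=> Wt ty; set p := 'X^k * W.[- t]%:P - (- t) ^+ k *: W.
have /factor_theorem[q pq] : root p (- t).
  by rewrite /root /p !hornerE subrr.
have E : y ^+ k * W.[- t] - (- t) ^+ k * W.[y] = q.[y] * (y + t).
  by have := congr1 (horner^~ y) pq; rewrite /p !hornerE opprK.
rewrite /interp_kernel hornerZ -/p pq mulpK; last by rewrite polyXsubC_eq0.
have -> : q.[y] = (y ^+ k * W.[- t] - (- t) ^+ k * W.[y]) / (t + y).
  by rewrite E [y + t]addrC mulfK.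
by rewrite -[- t]mulN1r exprMn mulN1r; field; rewrite ty.
Qed.

(** A form of Hermite's remainder formula that needs no contour integral.
    Integrating the identity horner_interp_kernel over t = (e w)^2 turns
    1 / (t + x^2) into a multiple of 1 / x and interp_kernel into a polynomial:
    for each w the kernel is recovered from its values at N fixed nodes, so its
    integral is the Lagrange combination of the integrals of these values. *)
Lemma interpolation_error (W : {poly R}) (k N : nat) (e K : R) :
  0 < e -> (k < N)%N -> (size W <= N.+1)%N ->
  (forall w, W.[- (e * w) ^+ 2] != 0) ->
  (forall w, `|((e * w) ^+ 2) ^+ k / W.[- (e * w) ^+ 2]| <= K) ->
  exists2 q : {poly R}, (size q <= N)%N &
  forall x, 0 < x -> x ^+ (2 * k) / x - q.[x ^+ 2] =
    2 * e / pi * (-1) ^+ k * W.[x ^+ 2] *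
    \int[mu]_(w in D) (((e * w) ^+ 2) ^+ k / W.[- (e * w) ^+ 2]
       * ((e * w) ^+ 2 + x ^+ 2)^-1).
Proof.
move=> e0 kN sW W0 WK; have mD := measurable_half_line.
pose h w : R := ((e * w) ^+ 2) ^+ k / W.[- (e * w) ^+ 2].
have ch : continuous h.
  move=> w; have csq : {for w, continuous (fun w : R => (e * w) ^+ 2)}.
    rewrite /prop_for /continuous_at expr2; under eq_fun do rewrite expr2.
    by apply: cvgM; apply: cvgM; (exact: cvg_cst || exact: cvg_id).
  apply: cvgM.
    apply: (@continuous_comp _ _ _ (fun w : R => (e * w) ^+ 2) (fun z => z ^+ k)).
      exact: csq.
    exact: exprn_continuous.
  apply: cvgV => //.
  apply: (@continuous_comp _ _ _ (fun w : R => - (e * w) ^+ 2) (horner W)).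
    exact: cvgN csq.
  exact: continuous_horner.
have ih x : 0 < x ->
    mu.-integrable D (EFin \o (fun w => h w * ((e * w) ^+ 2 + x ^+ 2)^-1)).
  move=> x0; apply: (@integrable_le_Cauchy _ K e x) => //.
    by move=> w; apply: cvgM; [exact: ch|exact: continuous_Cauchy].
  move=> w _; rewrite normrM [X in _ * X]ger0_norm ?invr_ge0 ?addr_ge0 ?sqr_ge0//.
  by rewrite ler_wpM2r ?invr_ge0 ?addr_ge0 ?sqr_ge0//; exact: WK.
have den w x : 0 < x -> (e * w) ^+ 2 + x ^+ 2 != 0.
  by move=> x0; rewrite gt_eqF// ltr_wpDl ?sqr_ge0 ?exprn_gt0.
pose P w := interp_kernel W k ((e * w) ^+ 2).
have PE w x : 0 < x -> (P w).[x ^+ 2] =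
    x ^+ (2 * k) * ((e * w) ^+ 2 + x ^+ 2)^-1 -
    (-1) ^+ k * W.[x ^+ 2] * (h w * ((e * w) ^+ 2 + x ^+ 2)^-1).
  by move=> x0; rewrite horner_interp_kernel ?den// exprM.
have iC (x c : R) (x0 : 0 < x) := integrableZl mD c (integrable_Cauchy e0 x0).
have iH (x c : R) (x0 : 0 < x) := integrableZl mD c (ih _ x0).
have iP x : 0 < x -> mu.-integrable D (EFin \o (fun w => (P w).[x ^+ 2])).
  move=> x0; rewrite (funext (PE^~ x ^~ x0)).
  have H := integrableB mD (iC x (x ^+ (2 * k)) x0)
    (iH x ((-1) ^+ k * W.[x ^+ 2]) x0).
  exact: H.
have IP x : 0 < x -> \int[mu]_(w in D) (P w).[x ^+ 2] =
    x ^+ (2 * k) * (pi / (2 * e * x)) - (-1) ^+ k * W.[x ^+ 2] *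
     \int[mu]_(w in D) (h w * ((e * w) ^+ 2 + x ^+ 2)^-1).
  move=> x0; under eq_Rintegral do rewrite PE//.
  rewrite RintegralB//; [|exact: iC|exact: iH].
  rewrite RintegralZl//; last exact: integrable_Cauchy.
  rewrite RintegralZl//; last exact: ih.
  by rewrite {1}/Rintegral Cauchy_integral.
have N0 : (0 < N)%N by case: (N) kN.
(* Any N distinct positive nodes serve here. *)
pose node (i : nat) : R := i.+1%:R.
have node_inj : injective node by move=> i j /eqP; rewrite eqr_nat => /eqP [].
have node0 i : 0 < Num.sqrt (node i) by rewrite sqrtr_gt0 ltr0n.
have nodeE i : node i = Num.sqrt (node i) ^+ 2 by rewrite sqr_sqrtr ?ler0n.
pose I i := \int[mu]_(w in D) (P w).[node i].
pose q0 : {poly R} := \sum_(i < N) (I i)%:P * tnth (qpoly.lagrange N node) i.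
have Pexp w y : (P w).[y] =
    \sum_(i < N) (P w).[node i] * (tnth (qpoly.lagrange N node) i : {poly R}).[y].
  have sP := size_interp_kernel ((e * w) ^+ 2) kN sW.
  rewrite {1}/P (qpoly.lagrange_gen N0 node_inj sP) horner_sum.
  by apply: eq_bigr => i _; rewrite hornerCM.
have IPq x : 0 < x -> \int[mu]_(w in D) (P w).[x ^+ 2] = q0.[x ^+ 2].
  move=> x0; under eq_Rintegral do rewrite Pexp.
  rewrite Rintegral_sum => [|i]; last by rewrite nodeE; exact: iP.
  by rewrite /q0 horner_sum; apply: eq_bigr => i _; rewrite hornerCM.
exists ((2 * e / pi) *: q0).
  rewrite (leq_trans (size_scale_leq _ _))//.
  apply: (leq_trans (size_sum _ _ _)); apply/bigmax_leqP => i _.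
    rewrite mul_polyC (leq_trans (size_scale_leq _ _))//.
move=> x x0; rewrite hornerZ -IPq// IP//.
move: (pi) (pi_gt0 R) => p p0.
by field; rewrite !gt_eqF.
Qed.

End CauchyKernel.

(** * The gamma function at half-integers *)

Section GammaHalf.
Variable R : realType.
Local Notation mu := (@lebesgue_measure R).
Local Notation D := (`[0, +oo[%classic : set R).

(* The exponents are shifted by one: h k is the integrand of Gamma at k + 3/2,
   and g k is what the substitution t = w^2 makes of it. *)
Let h (k : nat) (t : R) := t ^+ k * Num.sqrt t * expR (- t).
Let g (k : nat) (w : R) := 2 * (w ^+ (2 * k.+1) * expR (- w ^+ 2)).

Let continuous_h k : continuous (h k).
Proof.
move=> t; apply: cvgM; last first.
  by apply: (@continuous_comp _ _ _ -%R expR); [exact: cvgN|exact: continuous_expR].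
by apply: cvgM; [exact: exprn_continuous|exact: sqrt_continuous].
Qed.

Let continuous_g k : continuous (g k).
Proof.
move=> t; apply: cvgM; first exact: cvg_cst.
apply: cvgM; first exact: exprn_continuous.
apply: (@continuous_comp _ _ _ (fun w : R => - w ^+ 2) expR).
  by apply: cvgN; exact: exprn_continuous.
exact: continuous_expR.
Qed.

Let h_ge0 k t : 0 <= t -> 0 <= h k t.
Proof.
by move=> t0; rewrite /h !mulr_ge0 ?exprn_ge0 ?sqrtr_ge0 ?expR_ge0.
Qed.

Let g_ge0 k w : 0 <= g k w.
Proof.
by rewrite /g mulr_ge0// mulr_ge0 ?expR_ge0// mulnC exprM sqr_ge0.
Qed.

Let integral_split (f : R -> R) :
  continuous f -> (forall x, 0 <= x -> 0 <= f x) ->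
  (\int[mu]_(x in `[0%R, +oo[) (f x)%:E =
   \int[mu]_(x in `[0%R, 1%R]) (f x)%:E +
   \int[mu]_(x in `[1%R, +oo[) (f x)%:E)%E.
Proof.
move=> cf f0.
have mf (A : set (g_sigma_algebraType R.-ocitv.-measurable)) :
    measurable_fun A (fun x => (f x)%:E).
  apply: (@measurable_funS _ _ _ _ setT) => //.
  by apply/measurable_EFinP; exact: continuous_measurable_fun.
rewrite (@itv_bndbnd_setU _ _ _ (BRight (1 : R)))//; last by rewrite bnd_simp.
rewrite ge0_integral_setU//=.
- by congr (_ + _)%E; apply: integral_itv_obnd_cbnd; exact: mf.
- move=> x []; rewrite in_itv/= => /andP[x0 _]; rewrite lee_fin f0//.
  by rewrite (le_trans ler01)// ltW.
- apply/disj_setPS => y [/=]; rewrite 2!in_itv/= => /andP[_ y1] /andP[].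
  by rewrite ltNge y1.
Qed.

Lemma derive1_sqr (x : R) : derive1 (fun w : R => w ^+ 2) x = 2 * x.
Proof. by rewrite exp_derive1 expr1. Qed.

Let integral_sub01 k :
  (\int[mu]_(x in `[0%R, 1%R]) (h k x)%:E =
   \int[mu]_(x in `[0%R, 1%R]) (g k x)%:E)%E.
Proof.
pose F (w : R) : R := w ^+ 2.
have F0 : F 0 = 0 by rewrite /F expr0n.
have F1 : F 1 = 1 by rewrite /F expr1n.
have F'E : derive1 F = (fun x => 2 * x) by apply/funext => x; exact: derive1_sqr.
have cF : continuous F by exact: exprn_continuous.
have cF' : continuous (derive1 F).
  by rewrite F'E => x; apply: cvgM; [exact: cvg_cst|exact: cvg_id].
have := @integration_by_substitution_increasing R F (h k) 0 1 ler01.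
rewrite F0 F1 => ->.
- apply: eq_integral => x; rewrite inE/= in_itv/= => /andP[x0 _]; congr EFin.
  rewrite fctE F'E /h /g /= /F sqrtr_sqr ger0_norm// -exprM mulnS exprD expr2.
  by rewrite mulnC; ring.
- move=> x y; rewrite !in_itv/= => /andP[x0 _] /andP[y0 _] xy.
  by rewrite /F ltr_pXn2r.
- by move=> x _; exact: cF'.
- by apply/cvg_ex; exists (derive1 F 0); apply: cvg_at_right_filter; exact: cF'.
- by apply/cvg_ex; exists (derive1 F 1); apply: cvg_at_left_filter; exact: cF'.
- split.
  + by move=> x _; exact: exprn_derivable.
  + by apply: cvg_at_right_filter; exact: cF.
  + by apply: cvg_at_left_filter; exact: cF.
- by apply: continuous_subspaceT; exact: continuous_h.
Qed.

Let integral_sub1y k :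
  (\int[mu]_(x in `[1%R, +oo[) (g k x)%:E =
   \int[mu]_(x in `[1%R, +oo[) (h k x)%:E)%E.
Proof.
pose F (w : R) : R := Num.sqrt w.
have F1 : F 1 = 1 by rewrite /F sqrtr1.
have F'E x : 0 < x -> derive1 F x = (2 * Num.sqrt x)^-1.
  by move=> x0; rewrite derive1E; apply: derive_val; exact: is_derive1_sqrt.
have Fy : F x @[x --> +oo%R] --> +oo%R.
  apply/cvgryPge => A; near=> x.
  have Ax : A ^+ 2 <= x.
    near: x. by apply: nbhs_pinfty_ge; rewrite num_real.
  by rewrite (le_trans (ler_norm A))// -sqrtr_sqr ler_wsqrtr.
have cF' (x : R) : 0 < x -> derive1 F @ x --> derive1 F x.
  move=> x0; rewrite F'E//.
  have H : (2 * Num.sqrt y)^-1 @[y --> x] --> (2 * Num.sqrt x)^-1.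
    apply: cvgV; first by rewrite gt_eqF// mulr_gt0// sqrtr_gt0.
    by apply: cvgM; [exact: cvg_cst|exact: sqrt_continuous].
  apply: cvg_trans H; apply: near_eq_cvg; near=> y; rewrite F'E//.
  by near: y; exact: lt_nbhsr.
have := @increasing_ge0_integration_by_substitutiony R F (g k) 1.
rewrite F1 => ->.
- apply: eq_integral => x; rewrite inE/= in_itv/= andbT => x1; congr EFin.
  have x0 : 0 < x by apply: lt_le_trans x1.
  rewrite fctE F'E// /h /g /= /F exprM sqr_sqrtr ?ltW// exprS.
  rewrite -{1}(sqr_sqrtr (ltW x0)); field.
  by rewrite gt_eqF ?sqrtr_gt0.
- move=> x y; rewrite !in_itv/= !andbT => x1 y1 xy.
  by rewrite /F ltr_sqrt// (lt_le_trans _ y1).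
- by move=> x; rewrite in_itv/= andbT => x1; apply: cF'; apply: lt_trans x1.
- by apply/cvg_ex; exists (derive1 F 1); apply: cvg_at_right_filter; exact: cF'.
- apply/cvg_ex; exists 0.
  have H : 2^-1 * (F x)^-1 @[x --> +oo%R] --> (2^-1 * 0 : R).
    apply: cvgM; first exact: cvg_cst.
    apply/gtr0_cvgV0 => //; near=> x; rewrite sqrtr_gt0.
    by near: x; exact: nbhs_pinfty_gt.
  rewrite mulr0 in H; apply: cvg_trans H; apply: near_eq_cvg; near=> y.
  have y0 : 0 < y by near: y; exact: nbhs_pinfty_gt.
  by rewrite F'E// invfM.
- split.
  + move=> x; rewrite in_itv/= andbT => x1.
    have x0 : 0 < x by apply: lt_trans x1.
    by apply: ex_derive; exact: is_derive1_sqrt.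
  + by apply: cvg_at_right_filter; exact: sqrt_continuous.
- exact: Fy.
- by apply: continuous_subspaceT; exact: continuous_g.
- by move=> x _; exact: g_ge0.
Unshelve. all: by end_near. Qed.

(** The substitution t = w^2.  Its derivative is unbounded at infinity and that
    of its inverse is unbounded at 0, so w |-> w^2 is used on [0, 1] and
    t |-> sqrt t on [1, +oo[. *)
Lemma Gamma_half k : (1 <= k)%N -> Gamma (k%:R + 1 / 2 : R) =
  fine (\int[mu]_(w in D) (2 * (w ^+ (2 * k) * expR (- w ^+ 2)))%:E)%E.
Proof.
case: k => // k _; rewrite /Gamma /Rintegral; congr fine.
have -> : (\int[mu]_(x in `]0%R, +oo[)
      (x `^ (k.+1%:R + 1 / 2 - 1) * expR (- x))%:E)%E =
    (\int[mu]_(x in `]0%R, +oo[) (h k x)%:E)%E.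
  apply: eq_integral => x; rewrite inE/= in_itv/= andbT => x0; congr EFin.
  rewrite /h; congr (_ * _).
  have -> : k.+1%:R + 1 / 2 - 1 = k%:R + 2^-1 :> R by rewrite -natr1; ring.
  rewrite powRD ?powR_mulrn ?powR12_sqrt ?ltW//.
  by apply/implyP; rewrite gt_eqF.
rewrite integral_itv_obnd_cbnd; last first.
  apply: (@measurable_funS _ _ _ _ setT) => //.
  by apply/measurable_EFinP; apply: continuous_measurable_fun; exact: continuous_h.
rewrite integral_split; [|exact: continuous_h|exact: h_ge0].
by rewrite integral_sub01 -integral_sub1y -integral_split.
Qed.

End GammaHalf.

(** * The node polynomial on the negative axis *)

Section NegativeAxis.
Variable R : realType.
Variables (a : R) (ha : 0 < a < 1).
Local Notation r := (rate a).
Local Notation beta := (1 - r ^+ 2).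

Lemma one_sub_rate_sqr : beta = 4 * a / (1 + a) ^+ 2.
Proof.
have /andP[a0 a1] := ha; rewrite /rate; field.
by rewrite gt_eqF// addr_gt0.
Qed.

Lemma one_sub_rate_sqr_gt0 : 0 < beta.
Proof.
by have := rate_gt0 ha; have := rate_lt1 ha; rewrite subr_gt0 => *; nra.
Qed.

Lemma one_sub_rate_sqr_lt1 : beta < 1.
Proof. by rewrite ltrBlDr ltrDl exprn_gt0// rate_gt0. Qed.

(** The point - t of the negative axis corresponds to z = - (1 + v) / r with
    v >= 0 the root of v (v + 1 - r^2) = T (1 + v), where
    T = 4 t / (1 + a)^2. *)
Definition excess (T : R) : R :=
  ((T - beta) + Num.sqrt ((T - beta) ^+ 2 + 4 * T)) / 2.

Lemma excess_eq T : 0 <= T -> excess T * (excess T + beta) = T * (1 + excess T).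
Proof.
move=> T0; rewrite /excess; set b := beta.
have : Num.sqrt ((T - b) ^+ 2 + 4 * T) ^+ 2 = (T - b) ^+ 2 + 4 * T.
  by rewrite sqr_sqrtr// addr_ge0 ?sqr_ge0 ?mulr_ge0.
set s := Num.sqrt _ => sE.
suff : 4 * (T - b + s) / 2 * ((T - b + s) / 2 + b) =
       4 * T * (1 + (T - b + s) / 2) by move=> H; lra.
transitivity ((T - b) ^+ 2 + 2 * b * (T - b + s) + 2 * (T - b) * s + s ^+ 2).
  by field.
by rewrite sE; field.
Qed.

Lemma excess_ge0 T : 0 <= T -> 0 <= excess T.
Proof.
move=> T0; rewrite /excess divr_ge0//.
have H : `|T - beta| <= Num.sqrt ((T - beta) ^+ 2 + 4 * T).
  by rewrite -sqrtr_sqr ler_wsqrtr// lerDl mulr_ge0.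
have := ler_norm (- (T - beta)); rewrite normrN; lra.
Qed.

Lemma excess_bounds T : 0 <= T -> T <= excess T <= T / beta.
Proof.
move=> T0; have v0 := excess_ge0 T0; have E := excess_eq T0.
have b0 := one_sub_rate_sqr_gt0; have b1 := one_sub_rate_sqr_lt1.
move: beta (excess T) b0 b1 v0 E => b v b0 b1 v0 E.
have v1 : 0 < 1 + v by lra.
have vb : 0 <= v * (1 - b) by rewrite mulr_ge0// subr_ge0 ltW.
rewrite ler_pdivlMr//; apply/andP; split.
  by rewrite -(ler_pM2r v1) -E; nra.
by rewrite -(ler_pM2r v1) -E; nra.
Qed.

(** Of the two summands of the node polynomial, the one with z^N dominates on
    the negative axis, and the other is at most r^N times as large.  They have
    opposite signs because L is odd, whence the one-sided bounds. *)
Lemma node_poly_negative_axis L N t v M : odd L -> (L <= N)%N -> 0 <= t ->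
  v = excess (4 * t / (1 + a) ^+ 2) ->
  M = (1 + v) ^+ N * (1 - r ^+ 2 / (1 + v)) ^+ L ->
  (1 - r ^+ N) * M <= (-1) ^+ N * r ^+ N * (node_poly a L N).[- t] <= M.
Proof.
move=> oddL LN t0; set T := 4 * t / _; move=> vE ME.
have /andP[a0 a1] := ha; have r0 := rate_gt0 ha; have r1 := rate_lt1 ha.
have T0 : 0 <= T by rewrite /T divr_ge0 ?sqr_ge0// mulr_ge0.
have v0 : 0 <= v by rewrite vE excess_ge0.
have E : v * (v + beta) = T * (1 + v) by rewrite vE excess_eq.
have v1 : 0 < 1 + v by lra.
have r0' : r != 0 by rewrite gt_eqF.
have v1' : 1 + v != 0 by rewrite gt_eqF.
pose z := - ((1 + v) / r).
have z0 : z != 0 by rewrite oppr_eq0 mulf_neq0// invr_neq0.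
have zE : (to_joukowski a).[- t] = z + z^-1.
  have t_eq : t = (1 + a) ^+ 2 / 4 * (v * (v + beta) / (1 + v)).
    by rewrite E mulfK// /T; field; rewrite gt_eqF//; lra.
  rewrite horner_to_joukowski t_eq /z /rate; field.
  rewrite !gt_eqF//; do ?[lra | nra].
have g0 : 0 < 1 - r ^+ 2 / (1 + v).
  by rewrite subr_gt0 ltr_pdivrMr// mul1r; nra.
set g := 1 - r ^+ 2 / (1 + v) in ME g0 *.
have M0 : 0 <= M by rewrite ME mulr_ge0// exprn_ge0// ltW.
have -> : (-1) ^+ N * r ^+ N * (node_poly a L N).[- t] =
    M - r ^+ N * (r ^+ N * v ^+ L / (1 + v) ^+ N).
  rewrite /node_poly (wchebyshev_joukowski _ z0 zE LN).
  have -> : 1 + r / z = g by rewrite /g /z; field; rewrite r0' v1'.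
  have -> : 1 + r * z = - v by rewrite /z; field.
  rewrite ME /z -exprVn invrN.
  have sL : (-1) ^+ L = -1 :> R by rewrite -signr_odd oddL expr1.
  rewrite (exprNn v) sL mulN1r.
  rewrite (exprNn _^-1) (exprNn (_ / r)) exprVn (expr_div_n (1 + v) r) mulrDr.
  have s1 : (-1) ^+ N * (-1) ^+ N = 1 :> R by rewrite -expr2 sqrr_sign.
  have rN0 : r ^+ N != 0 by rewrite expf_neq0.
  have vN0 : (1 + v) ^+ N != 0 by rewrite expf_neq0.
  move: ((-1) ^+ N) (r ^+ N) ((1 + v) ^+ N) (g ^+ L) (v ^+ L) s1 rN0 vN0.
  move=> s p q x y s1 p0 q0.
  transitivity (s * s * (q * x - p * (p * y / q))); last by rewrite s1 mul1r.
  by field; rewrite p0 q0.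
have small0 : 0 <= r ^+ N * v ^+ L / (1 + v) ^+ N.
  by rewrite divr_ge0// ?mulr_ge0 ?exprn_ge0// ltW.
have smallM : r ^+ N * v ^+ L / (1 + v) ^+ N <= M.
  rewrite ler_pdivrMr ?exprn_gt0// ME.
  have H1 : r ^+ N * v ^+ L <= (r * v) ^+ L.
    by rewrite (exprMn _ r v) ler_wpM2r ?exprn_ge0// ler_wiXn2l// ltW.
  have H2 : (r * v) ^+ L <= ((1 + v) * g) ^+ L.
    have rv0 : 0 <= r * v by rewrite mulr_ge0// ltW.
    have vg0 : 0 <= (1 + v) * g by rewrite mulr_ge0// ltW.
    apply: lerXn2r; rewrite ?nnegrE//.
    by rewrite /g mulrBr mulr1 mulrCA divff// mulr1; nra.
  apply: (le_trans H1); apply: (le_trans H2).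
  rewrite (exprMn _ (1 + v)) [leRHS]mulrAC -exprD.
  apply: ler_wpM2r; first by rewrite exprn_ge0// ltW.
  apply: ler_weXn2l; first by lra.
  by rewrite (leq_trans LN)// leq_addr.
have rN0 : 0 <= r ^+ N by rewrite exprn_ge0// ltW.
by apply/andP; split; nra.
Qed.

End NegativeAxis.

(** * Asymptotics of the error integrals *)

Section Laplace.
Variable R : realType.
Local Notation mu := (@lebesgue_measure R).
Local Notation D := (`[0, +oo[%classic : set R).

Lemma Bernoulli_inequality (y : R) (n : nat) : 0 <= y ->
  1 + n%:R * y <= (1 + y) ^+ n.
Proof.
move=> y0; elim: n => [|n IH]; first by rewrite mul0r addr0 expr0.
rewrite exprS -natr1; have n0 : 0 <= n%:R :> R by [].
have : (1 + y) * (1 + n%:R * y) <= (1 + y) * (1 + y) ^+ n.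
  by rewrite ler_wpM2l// addr_ge0.
by apply: le_trans; nra.
Qed.

(** A power of fixed exponent p below (1 + x/N)^N, uniformly in N >= p: split N
    into p blocks of length N / p and use Bernoulli in each block; the factor 2
    pays for the remainder of the division. *)
Lemma expr_one_add_div_ge (x : R) (p N : nat) : 0 <= x -> (0 < p <= N)%N ->
  (1 + x / (2 * p%:R)) ^+ p <= (1 + x / N%:R) ^+ N.
Proof.
move=> x0 /andP[p0 pN]; have N0 : (0 < N)%N by apply: leq_trans pN.
have q0 : (0 < N %/ p)%N by rewrite divn_gt0.
have xN0 : 0 <= x / N%:R by rewrite divr_ge0.
apply: (@le_trans _ _ ((1 + x / N%:R) ^+ (N %/ p * p))); last first.
  by apply: ler_weXn2l; [rewrite lerDl|exact: leq_trunc_div].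
rewrite exprM; apply: lerXn2r; rewrite ?nnegrE ?addr_ge0 ?exprn_ge0 ?divr_ge0//.
  by rewrite addr_ge0.
apply: le_trans (Bernoulli_inequality _ xN0); rewrite lerD2l mulrCA.
rewrite ler_wpM2l// ler_pdivlMr ?ltr0n// mulrC ler_pdivrMr ?mulr_gt0 ?ltr0n//.
rewrite -natrM -natrM ler_nat.
have := divn_eq N p; have := ltn_pmod N p0.
nia.
Qed.

Variables (a : R) (ha : 0 < a < 1) (k : nat).
Local Notation r := (rate a).
Local Notation beta := (1 - r ^+ 2).
Local Notation L := k.*2.+1.

(** With the substitution t = (scale N * w)^2 = a w^2 / N the factor a makes the
    exponent in the limit exactly w^2, since a = ((1 + a)/2)^2 (1 - r^2). *)
Definition scale N : R := Num.sqrt (a / N%:R).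

Definition growth N (w : R) : R :=
  (-1) ^+ N * r ^+ N * (node_poly a L N).[- (scale N * w) ^+ 2].

Let v N w := excess a (beta * w ^+ 2 / N%:R).

Lemma scale_sqr N w : (scale N * w) ^+ 2 = a / N%:R * w ^+ 2.
Proof.
by have /andP[a0 a1] := ha; rewrite exprMn sqr_sqrtr// divr_ge0// ltW.
Qed.

Let v_bounds N w : beta * w ^+ 2 / N%:R <= v N w <= w ^+ 2 / N%:R.
Proof.
have b0 := one_sub_rate_sqr_gt0 ha.
have T0 : 0 <= beta * w ^+ 2 / N%:R.
  by rewrite divr_ge0// mulr_ge0 ?sqr_ge0// ltW.
have := excess_bounds ha T0; rewrite -/(v N w) => /andP[-> H] /=.
by rewrite (le_trans H)// -mulrA mulrAC divff ?mul1r// gt_eqF.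
Qed.

Let v_ge0 N w : 0 <= v N w.
Proof.
rewrite (le_trans _ (andP (v_bounds N w)).1)// divr_ge0// mulr_ge0 ?sqr_ge0//.
by rewrite ltW// one_sub_rate_sqr_gt0.
Qed.

Let gap N w := 1 - r ^+ 2 / (1 + v N w).

Let gap_ge N w : beta <= gap N w.
Proof.
rewrite /gap lerD2l lerN2 ler_pdivrMr; last by have := v_ge0 N w; lra.
by rewrite ler_peMr ?sqr_ge0// lerDl.
Qed.

Lemma growth_bounds N w : (L <= N)%N ->
  (1 - r ^+ N) * ((1 + v N w) ^+ N * gap N w ^+ L) <= growth N w
    <= (1 + v N w) ^+ N * gap N w ^+ L.
Proof.
move=> LN; have /andP[a0 a1] := ha.
apply: (@node_poly_negative_axis _ _ ha L N _ (v N w)) => //.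
- by rewrite /= odd_double.
- by rewrite sqr_ge0.
by rewrite /v scale_sqr (one_sub_rate_sqr ha); congr (excess _ _); ring.
Qed.

Let c := beta / (2 * k.+1%:R).

Let c_gt0 : 0 < c.
Proof. by rewrite divr_gt0 ?mulr_gt0 ?ltr0n// one_sub_rate_sqr_gt0. Qed.

(** The exponent k + 1 is the least for which the lower bound makes
    w^(2k) / growth N w integrable on the half-line. *)
Lemma growth_ge N w : (L <= N)%N ->
  (1 - r) * beta ^+ L * (1 + c * w ^+ 2) ^+ k.+1 <= growth N w.
Proof.
move=> LN; have b0 := one_sub_rate_sqr_gt0 ha.
have r0 := rate_gt0 ha; have r1 := rate_lt1 ha.
have N0 : (0 < N)%N by apply: leq_trans LN.
apply: le_trans (andP (growth_bounds w LN)).1.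
rewrite -mulrA (mulrC (beta ^+ L)).
have bw0 : 0 <= beta * w ^+ 2 by rewrite mulr_ge0 ?sqr_ge0// ltW.
have r1N : 1 - r <= 1 - r ^+ N.
  rewrite lerD2l lerN2; case: (N) N0 => // n _.
  by rewrite exprS ler_piMr ?exprn_ile1// ltW.
have pow : (1 + c * w ^+ 2) ^+ k.+1 <= (1 + v N w) ^+ N.
  apply: (@le_trans _ _ ((1 + beta * w ^+ 2 / N%:R) ^+ N)).
    have -> : c * w ^+ 2 = beta * w ^+ 2 / (2 * k.+1%:R) by rewrite /c mulrAC.
    apply: expr_one_add_div_ge => //=.
    by rewrite (leq_trans _ LN)// ltnS -addnn leq_addr.
  apply: lerXn2r.
  - by rewrite nnegrE addr_ge0// divr_ge0.
  - by rewrite nnegrE addr_ge0// v_ge0.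
  by rewrite lerD2l; case/andP: (v_bounds N w).
have c0 : 0 <= 1 + c * w ^+ 2 by rewrite addr_ge0// mulr_ge0 ?sqr_ge0// ltW.
apply: ler_pM => //; first by rewrite subr_ge0 ltW.
  by rewrite mulr_ge0 ?exprn_ge0// ltW.
apply: ler_pM => //; rewrite ?exprn_ge0//; first exact: ltW.
by apply: lerXn2r; rewrite ?nnegrE// ?(le_trans (ltW b0)) ?gap_ge// ltW.
Qed.

Lemma growth_gt0 N w : (L <= N)%N -> 0 < growth N w.
Proof.
move=> LN; apply: lt_le_trans (growth_ge w LN).
have c1 : 0 < 1 + c * w ^+ 2 by rewrite ltr_wpDr// mulr_ge0 ?sqr_ge0// ltW.
by rewrite !mulr_gt0 ?exprn_gt0 ?one_sub_rate_sqr_gt0// subr_gt0 rate_lt1.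
Qed.

Let C := ((1 - r) * beta ^+ L * c ^+ k)^-1.

Let C_gt0 : 0 < C.
Proof.
rewrite invr_gt0 !mulr_gt0 ?exprn_gt0 ?one_sub_rate_sqr_gt0//.
by rewrite subr_gt0 rate_lt1.
Qed.

Lemma moment_growth_le N w : (L <= N)%N ->
  w ^+ (2 * k) / growth N w <= C * ((Num.sqrt c * w) ^+ 2 + 1 ^+ 2)^-1.
Proof.
move=> LN; have G0 := growth_gt0 w LN.
have b0 : 0 < (1 - r) * beta ^+ L.
  by rewrite mulr_gt0 ?exprn_gt0 ?one_sub_rate_sqr_gt0// subr_gt0 rate_lt1.
have cw0 : 0 <= c * w ^+ 2 by rewrite mulr_ge0 ?sqr_ge0// ltW.
rewrite (exprMn _ (Num.sqrt c)) sqr_sqrtr ?expr1n; last exact: ltW.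
rewrite ler_pdivrMr// -[leRHS]mulrA ler_pdivlMl; last first.
  by rewrite mulr_gt0// exprn_gt0.
rewrite ler_pdivlMl; last by rewrite ltr_wpDl.
apply: le_trans (growth_ge w LN).
rewrite [X in X <= _](_ : _ = (1 - r) * beta ^+ L *
  ((c * w ^+ 2) ^+ k * (1 + c * w ^+ 2))); last first.
  by rewrite (exprM w) (exprMn _ c); ring.
rewrite ler_wpM2l ?(ltW b0)// (exprSr _ k) ler_wpM2r ?addr_ge0//.
by apply: lerXn2r; rewrite ?nnegrE ?addr_ge0// lerDr.
Qed.

Lemma moment_growth_bounded N : (L <= N)%N ->
  exists K, forall w, w ^+ (2 * k) / growth N w <= K.
Proof.
move=> LN; exists C => w; apply: le_trans (moment_growth_le w LN) _.
rewrite ler_piMr ?(ltW C_gt0)// expr1n invf_le1 ?lerDr ?sqr_ge0//.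
by rewrite ltr_wpDl ?sqr_ge0.
Qed.

(** Here v = excess satisfies N v --> w^2, so (1 + v)^N lies between
    exp (N v / (1 + v)) and exp (N v), while 1 - r^2 / (1 + v) --> 1 - r^2. *)
Lemma growth_cvg (w : R) :
  growth (n + L) w @[n --> \oo] --> expR (w ^+ 2) * beta ^+ L.
Proof.
have b0 := one_sub_rate_sqr_gt0 ha.
have r0 := rate_gt0 ha; have r1 := rate_lt1 ha.
pose N n := (n + L)%N.
have Ngt0 n : 0 < (N n)%:R :> R by rewrite ltr0n /N addnS.
have Ny : (N n)%:R @[n --> \oo] --> (+oo : set_system R).
  have := @cvgr_idn R; rewrite -(cvg_shiftn L) => H.
  exact: H.
have N'0 : (N n)%:R^-1 @[n --> \oo] --> (0 : R).
  by apply/gtr0_cvgV0 => //; near=> n; exact: Ngt0.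
have v0 : v (N n) w @[n --> \oo] --> (0 : R).
  apply: (@squeeze_cvgr _ _ _ _ (fun=> 0) (fun n => w ^+ 2 / (N n)%:R)).
  - near=> n; rewrite v_ge0/=; by case/andP: (v_bounds (N n) w).
  - exact: cvg_cst.
  - by rewrite -(mulr0 (w ^+ 2)); apply: cvgM; [exact: cvg_cst|exact: N'0].
have v1 : 1 + v (N n) w @[n --> \oo] --> (1 : R).
  by rewrite -[X in _ --> X]addr0; apply: cvgD; [exact: cvg_cst|exact: v0].
have v1' : (1 + v (N n) w)^-1 @[n --> \oo] --> (1 : R).
  by rewrite -[X in _ --> X]invr1; apply: cvgV => //; rewrite oner_eq0.
have gapc : gap (N n) w @[n --> \oo] --> beta.
  rewrite -[X in _ - X]mulr1; apply: cvgB; first exact: cvg_cst.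
  by apply: cvgM; [exact: cvg_cst|exact: v1'].
have rN : 1 - r ^+ N n @[n --> \oo] --> (1 : R).
  rewrite -[X in _ --> X]subr0; apply: cvgB; first exact: cvg_cst.
  have := @cvg_expr R r; rewrite ger0_norm ?ltW// => /(_ r1).
  by rewrite -(cvg_shiftn L); apply.
have Nv : (N n)%:R * v (N n) w @[n --> \oo] --> w ^+ 2.
  have H : beta * w ^+ 2 * (1 + v (N n) w) / (v (N n) w + beta) @[n --> \oo] -->
      beta * w ^+ 2 * 1 / (0 + beta).
    apply: cvgM; first by apply: cvgM; [exact: cvg_cst|exact: v1].
    apply: cvgV; first by rewrite add0r gt_eqF.
    by apply: cvgD; [exact: v0|exact: cvg_cst].
  have -> : w ^+ 2 = beta * w ^+ 2 * 1 / (0 + beta).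
    by rewrite mulr1 add0r mulrAC divff ?mul1r// gt_eqF.
  apply: cvg_trans H; apply: near_eq_cvg; near=> n.
  have vb : 0 < v (N n) w + beta by rewrite ltr_wpDl.
  have T0 : 0 <= beta * w ^+ 2 / (N n)%:R.
    by rewrite divr_ge0// mulr_ge0 ?sqr_ge0// ltW.
  apply/eqP; rewrite eq_sym; apply/eqP/(canRL (mulfK (lt0r_neq0 vb))).
  have E : v (N n) w * (v (N n) w + beta) =
    beta * w ^+ 2 / (N n)%:R * (1 + v (N n) w) := excess_eq a T0.
  rewrite -[LHS]mulrA E mulrA; congr (_ * _).
  by rewrite mulrC divfK// lt0r_neq0.
have Nv' : (N n)%:R * v (N n) w / (1 + v (N n) w) @[n --> \oo] --> w ^+ 2.
  by rewrite -[X in _ --> X]mulr1; apply: cvgM; [exact: Nv|exact: v1'].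
have gapL : gap (N n) w ^+ L @[n --> \oo] --> beta ^+ L.
  exact: (continuous_cvg _ (@exprn_continuous _ L _) gapc).
have expv : (1 + v (N n) w) ^+ N n @[n --> \oo] --> expR (w ^+ 2).
  apply: (@squeeze_cvgr _ _ _ _
    (fun n => expR ((N n)%:R * v (N n) w / (1 + v (N n) w)))
    (fun n => expR ((N n)%:R * v (N n) w))).
  - near=> n; set x := v (N n) w; have x0 : 0 <= x by exact: v_ge0.
    have x1 : 0 < 1 + x by rewrite ltr_wpDr.
    apply/andP; split.
      rewrite -mulrA expRM_natl.
      apply: lerXn2r; rewrite ?nnegrE ?expR_ge0 ?(ltW x1)//.
      have := expR_ge1Dx (- (x / (1 + x))).
      have -> : 1 + - (x / (1 + x)) = (1 + x)^-1.
        by field; rewrite gt_eqF.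
      by rewrite expRN lef_pV2 ?posrE ?expR_gt0.
    rewrite expRM_natl.
    by apply: lerXn2r; rewrite ?nnegrE ?expR_ge0 ?(ltW x1)// expR_ge1Dx.
  - exact: (continuous_cvg _ (@continuous_expR _ _) Nv').
  - exact: (continuous_cvg _ (@continuous_expR _ _) Nv).
have top : (1 + v (N n) w) ^+ N n * gap (N n) w ^+ L @[n --> \oo] -->
    expR (w ^+ 2) * beta ^+ L.
  by apply: cvgM; [exact: expv|exact: gapL].
apply: (@squeeze_cvgr _ _ _ _
  (fun n => (1 - r ^+ N n) * ((1 + v (N n) w) ^+ N n * gap (N n) w ^+ L))
  (fun n => (1 + v (N n) w) ^+ N n * gap (N n) w ^+ L)).
- by near=> n; apply: growth_bounds; rewrite leq_addl.
- by rewrite -[X in _ --> X]mul1r; apply: cvgM; [exact: rN|exact: top].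
- exact: top.
Unshelve. all: by end_near. Qed.

Lemma continuous_growth N : continuous (growth N).
Proof.
move=> w; apply: cvgM; first exact: cvg_cst.
apply: (@continuous_comp _ _ _ (fun w : R => - (scale N * w) ^+ 2)
  (horner (node_poly a L N))); last exact: continuous_horner.
apply: cvgN; apply: (@continuous_comp _ _ _ (fun w : R => scale N * w)
  (fun x => x ^+ 2)); last exact: exprn_continuous.
by apply: cvgM; [exact: cvg_cst|exact: cvg_id].
Qed.

Lemma continuous_moment_growth N (phi : R -> R) : (L <= N)%N ->
  continuous phi -> continuous (fun w : R => w ^+ (2 * k) / growth N w * phi w).
Proof.
move=> LN cphi w; apply: cvgM; last exact: cphi.
apply: cvgM; first exact: exprn_continuous.
by apply: cvgV; [rewrite gt_eqF// growth_gt0|exact: continuous_growth].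
Qed.

Lemma moment_growth_ge0 N w : (L <= N)%N -> 0 <= w ^+ (2 * k) / growth N w.
Proof.
move=> LN; rewrite divr_ge0 ?(ltW (growth_gt0 w LN))//.
by rewrite exprM exprn_ge0 ?sqr_ge0.
Qed.

Lemma normr_moment_growth_le N (phi : R -> R) w : (L <= N)%N ->
  (forall w, 0 <= phi w <= 1) ->
  `|w ^+ (2 * k) / growth N w * phi w|
    <= C * ((Num.sqrt c * w) ^+ 2 + 1 ^+ 2)^-1.
Proof.
move=> LN phi01; have /andP[p0 p1] := phi01 w.
apply: le_trans (moment_growth_le w LN).
have M0 := moment_growth_ge0 w LN.
by rewrite normrM !ger0_norm// ler_piMr.
Qed.

Lemma integrable_moment_growth N (phi : R -> R) : (L <= N)%N ->
  continuous phi -> (forall w, 0 <= phi w <= 1) ->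
  mu.-integrable D (EFin \o (fun w => w ^+ (2 * k) / growth N w * phi w)).
Proof.
move=> LN cphi phi01; apply: (@integrable_le_Cauchy _ _ C (Num.sqrt c) 1) => //.
- by rewrite sqrtr_gt0.
- exact: continuous_moment_growth.
- by move=> w _; exact: normr_moment_growth_le.
Qed.

(** Dominated convergence for the Laplace-type integrals that measure the error;
    the factors phi n stand for the Cauchy kernel x^2 / (t + x^2), which is
    close to 1 where the mass concentrates. *)
Lemma integral_moment_growth_cvg (phi : nat -> R -> R) : (1 <= k)%N ->
  (forall n, continuous (phi n)) -> (forall n w, 0 <= phi n w <= 1) ->
  (forall w, phi n w @[n --> \oo] --> (1 : R)) ->
  \int[mu]_(w in D) (w ^+ (2 * k) / growth (n + L) w * phi n w) @[n --> \oo]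
    --> Gamma (k%:R + 1 / 2 : R) / 2 / beta ^+ L.
Proof.
move=> k1 cphi phi01 phi1; have b0 := one_sub_rate_sqr_gt0 ha.
have mD := @measurable_half_line R.
pose lim w : R := w ^+ (2 * k) / (expR (w ^+ 2) * beta ^+ L).
have clim : continuous lim.
  move=> w; apply: cvgM; first exact: exprn_continuous.
  apply: cvgV; first by rewrite gt_eqF// mulr_gt0 ?expR_gt0 ?exprn_gt0.
  apply: cvgM; last exact: cvg_cst.
  by apply: (@continuous_comp _ _ _ (fun x : R => x ^+ 2) expR);
    [exact: exprn_continuous|exact: continuous_expR].
pose f n w := w ^+ (2 * k) / growth (n + L) w * phi n w.
have cf n : continuous (f n).
  by apply: continuous_moment_growth; [exact: leq_addl|exact: cphi].
have flim w : f n w @[n --> \oo] --> lim w.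
  rewrite -[lim w]mulr1; apply: cvgM; last exact: phi1.
  apply: cvgM; first exact: cvg_cst.
  apply: cvgV; last exact: growth_cvg.
  by rewrite gt_eqF// mulr_gt0 ?expR_gt0 ?exprn_gt0.
have c0 : 0 < Num.sqrt c by rewrite sqrtr_gt0.
have ig := integrableZl mD C (integrable_Cauchy c0 ltr01).
have [||||ilim _] := @dominated_convergence _ _ R mu D mD
  (fun n => EFin \o f n) (EFin \o lim) _ _ _ _ ig.
- by move=> n; apply/measurable_EFinP; exact: continuous_measurable_half_line (cf n).
- by apply/measurable_EFinP; exact: continuous_measurable_half_line clim.
- by apply: aeW => w _; apply: cvg_EFin; [exact: nearW|exact: flim].
- apply: aeW => w n _ /=; rewrite lee_fin normr_moment_growth_le ?leq_addl//.
move=> H.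
have -> : Gamma (k%:R + 1 / 2 : R) / 2 / beta ^+ L = \int[mu]_(w in D) lim w.
  have limE w : 2 * (w ^+ (2 * k) * expR (- w ^+ 2)) = 2 * beta ^+ L * lim w.
    rewrite /lim expRN; field; rewrite expf_neq0 ?gt_eqF ?expR_gt0//.
  rewrite Gamma_half//; under eq_integral do rewrite limE.
  rewrite -[fine _]/(Rintegral mu D (fun w => 2 * beta ^+ L * lim w)).
  rewrite RintegralZl//; field; rewrite expf_neq0// gt_eqF//.
apply: (@fine_cvg _ _ _ _ (fun n => \int[mu]_(w in D) (f n w)%:E)%E).
rewrite fineK; first exact: H.
exact: (integrable_fin_num mD ilim).
Qed.

End Laplace.

(** * Bounds for the error of best approximation *)

Section BestApproximation.
Variable R : realType.
Implicit Types (p q : {poly R}) (a x : R).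

(** N sign changes give N distinct roots, too many for a polynomial of degree
    less than N. *)
Lemma poly_alternation_absurd p (N : nat) (y : nat -> R) :
  (size p <= N)%N -> (forall j, (j < N)%N -> y j.+1 < y j) ->
  (forall j, (j <= N)%N -> 0 < (-1) ^+ j * p.[y j]) -> False.
Proof.
move=> sp yS yp.
have root_between j : exists z, (j < N)%N -> root p z /\ y j.+1 < z < y j.
  have [jN|] := boolP (j < N)%N; last by exists 0.
  have pj := yp _ (ltnW jN); have pj1 := yp _ jN.
  have prod_lt0 : p.[y j.+1] * p.[y j] < 0.
    have : 0 < ((-1) ^+ j * p.[y j]) * ((-1) ^+ j.+1 * p.[y j.+1]).
      exact: mulr_gt0.
    rewrite mulrACA exprS mulN1r mulrN -expr2 sqrr_sign mulN1r oppr_gt0.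
    by rewrite mulrC.
  have [z /andP[z1 z2] rz] : exists2 z, y j.+1 <= z <= y j & root p z.
    have [le0|gt0] := lerP p.[y j.+1] 0.
      by apply: poly_ivt; [exact/ltW/yS|rewrite le0/=; nra].
    have [||z z12 rz] := @poly_ivt _ (- p) (y j.+1) (y j); last first.
    - by exists z => //; rewrite -rootN.
    - by rewrite !hornerN; nra.
    - exact/ltW/yS.
  exists z => _; split=> //.
  rewrite !lt_neqAle z1 z2 !andbT; apply/andP; split; apply/eqP => zE.
    by move: prod_lt0; rewrite zE (rootP rz) mul0r ltxx.
  by move: prod_lt0; rewrite -zE (rootP rz) mulr0 ltxx.
have [z zP] := choice root_between.
have p0 : p != 0.
  by apply/eqP => p0; have := yp 0%N (leq0n _); rewrite p0 horner0 mulr0 ltxx.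
have y_anti i j : (i <= j)%N -> (j <= N)%N -> y j <= y i.
  elim: j => [|j IH]; first by rewrite leqn0 => /eqP ->.
  rewrite leq_eqVlt => /orP[/eqP -> //|ij jN].
  by apply: (le_trans (ltW (yS _ jN))); apply: IH => //; exact: ltnW.
have z_lt i j : (i < j)%N -> (j < N)%N -> z j < z i.
  move=> ij jN; have [_ /andP[_ zj]] := zP _ jN.
  have [_ /andP[zi _]] := zP _ (ltn_trans ij jN).
  by apply: lt_trans zi; apply: (lt_le_trans zj); exact: y_anti (ltnW jN).
have zu : uniq (map z (iota 0 N)).
  rewrite map_inj_in_uniq ?iota_uniq// => i j.
  rewrite !mem_iota /= !add0n => iN jN zij.
  case: (ltngtP i j) => // ij.
    by have := z_lt _ _ ij jN; rewrite zij ltxx.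
  by have := z_lt _ _ ij iN; rewrite zij ltxx.
have zr : all (root p) (map z (iota 0 N)).
  apply/allP => _ /mapP[i + ->]; rewrite mem_iota => /andP[_ iN].
  by have [] := zP _ iN.
have := max_poly_roots p0 zr zu; rewrite size_map size_iota ltnNge.
by rewrite sp.
Qed.

Definition laurent_poly k m (c : int -> R) : {poly R} :=
  \poly_(i < 2 * m + 2 * k - 1) c (i%:Z - (2 * k - 1)%N%:Z).

Lemma laurentE k m (c : int -> R) x : x != 0 ->
  laurent k m c x = (laurent_poly k m c).[x] / x ^+ (2 * k - 1).
Proof.
move=> x0; rewrite /laurent /laurent_poly horner_poly mulr_suml big_mkord.
apply: eq_bigr => i _; rewrite expfzDr// mulrA; congr (_ * _).
by rewrite -invr_expz.
Qed.

Lemma laurent_of_poly k m q x : (size q <= 2 * m + 2 * k - 1)%N -> x != 0 ->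
  laurent k m (fun j => q`_(absz (j + (2 * k - 1)%N%:Z))) x =
  q.[x] / x ^+ (2 * k - 1).
Proof.
move=> sq x0; rewrite laurentE//; congr (_ / _).
rewrite /laurent_poly horner_poly (horner_coef_wide _ sq).
by apply: eq_bigr => i _; rewrite subrK.
Qed.

Lemma horner_le_sum_coef p x : `|x| <= 1 ->
  `|p.[x]| <= \sum_(i < size p) `|p`_i|.
Proof.
move=> x1; rewrite horner_coef; apply: (le_trans (ler_norm_sum _ _ _)).
by apply: ler_sum => i _; rewrite normrM normrX ler_piMr// exprn_ile1.
Qed.

Lemma sgn_error_ge a k m (c : int -> R) x : 0 < a -> a <= `|x| <= 1 ->
  `|Num.sg x - laurent k m c x| <= sgn_error a (laurent k m c).
Proof.
move=> a0 ax1; apply: ub_le_sup; last by exists x.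
exists (1 + (\sum_(i < size (laurent_poly k m c)) `|(laurent_poly k m c)`_i|)
   / a ^+ (2 * k - 1)) => _ [y /= /andP[ay y1] <-].
have y0 : 0 < `|y| by apply: lt_le_trans ay.
rewrite (le_trans (ler_normB _ _))// lerD//.
  by rewrite normr_sg; case: (_ != 0).
rewrite laurentE -?normr_gt0// normrM normfV normrX.
apply: ler_pM => //; first exact: horner_le_sum_coef.
rewrite lef_pV2 ?posrE ?exprn_gt0//.
by apply: lerXn2r; rewrite ?nnegrE// ltW.
Qed.

Lemma sgn_error_le a (f : R -> R) M : 0 < a <= 1 ->
  (forall x, a <= `|x| <= 1 -> `|Num.sg x - f x| <= M) -> sgn_error a f <= M.
Proof.
move=> /andP[a0 a1] H; apply: ge_sup.
  by exists `|Num.sg 1 - f 1|, 1 => //=; rewrite normr1 a1 lexx.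
by move=> _ [x /= ax <-]; exact: H.
Qed.

Lemma best_error_le a k m q M : 0 < a <= 1 -> (1 <= k)%N -> (1 <= m)%N ->
  (size q <= m + k)%N ->
  (forall x, a <= x <= 1 ->
    `|x ^+ (2 * k - 1) - q.[x ^+ 2]| <= M * x ^+ (2 * k - 1)) ->
  best_error k m a <= M.
Proof.
move=> a01 k1 m1 sq qM; have /andP[a0 a1] := a01.
set d := (2 * k - 1)%N in qM *.
have dodd : odd d by rewrite /d; lia.
pose Q := q \Po 'X^2.
have sQ : (size Q <= 2 * m + 2 * k - 1)%N.
  rewrite (leq_trans (size_comp_poly_leq _ _))// size_polyXn.
  by move: (size q) sq => s; lia.
have QE x : Q.[x] = q.[x ^+ 2] by rewrite horner_comp hornerXn.
pose c (j : int) := Q`_(absz (j + (2 * k - 1)%N%:Z)).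
have bound x : a <= x <= 1 -> `|1 - q.[x ^+ 2] / x ^+ d| <= M.
  move=> ax; have x0 : 0 < x by case/andP: ax => ax _; apply: lt_le_trans ax.
  have xd : 0 < x ^+ d by rewrite exprn_gt0.
  rewrite -(ler_pM2r xd) -[X in `|_| * X]gtr0_norm// -normrM mulrBl mul1r.
  by rewrite divfK ?gt_eqF//; exact: qM.
apply: (@le_trans _ _ (sgn_error a (laurent k m c))).
  apply: ge_inf; last by exists c.
  exists 0 => _ [c' _ <-].
  by apply: le_trans (sgn_error_ge k m c' a0 (x := 1) _); rewrite ?normr1 ?a1 ?lexx.
apply: sgn_error_le => // x ax.
have x0 : x != 0 by rewrite -normr_gt0; case/andP: ax => ax _; apply: lt_le_trans ax.
rewrite laurent_of_poly// QE -/d.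
have [xneg|xpos|x00] := ltrgtP x 0; last by rewrite x00 eqxx in x0.
  rewrite ltr0_sg// -[in q.[_]]sqrrN.
  have -> : x ^+ d = - (- x) ^+ d.
    by rewrite exprNn -signr_odd dodd expr1 mulN1r opprK.
  rewrite invrN mulrN opprK -normrN opprD opprK.
  by apply: bound; rewrite -(ltr0_norm xneg).
by rewrite gtr0_sg//; apply: bound; rewrite -(gtr0_norm xpos).
Qed.

(** The lower bound of de la Vallee Poussin.  If some f does better than M, then
    the even part q' of x^(2k-1) f(x), seen as a polynomial in x^2, has degree
    less than m + k and is so close to x^(2k-1) at the points X j that q' - q
    alternates in sign there. *)
Lemma le_best_error a k m q M s (X : nat -> R) :
  0 < a <= 1 -> (1 <= k)%N -> (1 <= m)%N -> (size q <= m + k)%N ->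
  (forall j, (j <= m + k)%N -> a <= X j <= 1) ->
  (forall j, (j < m + k)%N -> X j.+1 < X j) ->
  (forall j, (j <= m + k)%N -> M * X j ^+ (2 * k - 1) <=
    (-1) ^+ s * (-1) ^+ j * (X j ^+ (2 * k - 1) - q.[X j ^+ 2])) ->
  M <= best_error k m a.
Proof.
move=> a01 k1 m1 sq Xa XS XM; have /andP[a0 a1] := a01.
set d := (2 * k - 1)%N in XM *; set N := (m + k)%N in sq Xa XS XM *.
have dodd : odd d by rewrite /d; lia.
apply: lb_le_inf; first by exists (sgn_error a (laurent k m (fun=> 0))), (fun=> 0).
move=> _ [c _ <-]; rewrite leNgt; apply/negP => errM.
pose Q := laurent_poly k m c; pose q' := even_poly Q.
have sq' : (size q' <= N)%N.
  rewrite (leq_trans (size_even_poly _))//.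
  have := size_poly (2 * m + 2 * k - 1) (fun i => c (i%:Z - d%:Z)).
  by rewrite -/(laurent_poly k m c) -/Q /N; move: (size Q) => n; lia.
have QE x : Q.[x] + Q.[- x] = 2 * q'.[x ^+ 2].
  have E y : Q.[y] = q'.[y ^+ 2] + (odd_poly Q).[y ^+ 2] * y.
    by rewrite -{1}(poly_even_odd Q) hornerD hornerM hornerX !horner_comp !hornerXn.
  by rewrite !E sqrrN; ring.
have X0 j : (j <= N)%N -> 0 < X j.
  by move=> /Xa /andP[aX _]; apply: lt_le_trans aX.
have q'M j : (j <= N)%N -> `|X j ^+ d - q'.[X j ^+ 2]| < M * X j ^+ d.
  move=> jN; have x0 := X0 _ jN; have /andP[ax x1] := Xa _ jN.
  have xd : 0 < X j ^+ d by rewrite exprn_gt0.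
  have e1 : `|X j ^+ d - Q.[X j]| < M * X j ^+ d.
    have : `|Num.sg (X j) - laurent k m c (X j)| < M.
      by apply: le_lt_trans errM; apply: sgn_error_ge; rewrite // gtr0_norm// ax.
    rewrite gtr0_sg// laurentE ?gt_eqF// -/d -/Q => H.
    rewrite -(ltr_pM2r xd) -[X in `|_| * X < _]gtr0_norm// -normrM in H.
    by rewrite mulrBl mul1r divfK ?gt_eqF// in H.
  have e2 : `|X j ^+ d - Q.[- X j]| < M * X j ^+ d.
    have : `|Num.sg (- X j) - laurent k m c (- X j)| < M.
      apply: le_lt_trans errM; apply: sgn_error_ge; rewrite // normrN.
      by rewrite gtr0_norm// ax.
    rewrite ltr0_sg ?oppr_lt0// laurentE ?oppr_eq0 ?gt_eqF// -/d -/Q => H.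
    rewrite -(ltr_pM2r xd) -[X in `|_| * X < _]gtr0_norm// -normrM in H.
    move: H; rewrite exprNn -signr_odd dodd expr1 mulN1r invrN mulrN opprK.
    rewrite mulrDl mulN1r divfK ?gt_eqF//.
    by rewrite -normrN opprD opprK.
  have -> : X j ^+ d - q'.[X j ^+ 2] =
      2^-1 * ((X j ^+ d - Q.[X j]) + (X j ^+ d - Q.[- X j])).
    by have := QE (X j) => H; lra.
  move: e1 e2; rewrite !ltr_norml => /andP[? ?] /andP[? ?].
  by apply/andP; split; lra.
apply: (@poly_alternation_absurd ((-1) ^+ s *: (q' - q)) N (fun j => X j ^+ 2)).
- rewrite (leq_trans (size_scale_leq _ _))// (leq_trans (size_polyD _ _))//.
  by rewrite size_polyN geq_max sq' sq.
- move=> j jN; have := X0 _ (ltnW jN); have := X0 _ jN; have := XS _ jN.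
  by nra.
- move=> j jN; rewrite hornerZ hornerD hornerN.
  have H1 := XM _ jN; have H2 := q'M _ jN.
  set e := X j ^+ d - q.[X j ^+ 2] in H1; set e' := X j ^+ d - q'.[X j ^+ 2] in H2.
  have -> : q'.[X j ^+ 2] - q.[X j ^+ 2] = e - e' by rewrite /e /e'; ring.
  rewrite mulrA [X in X * _]mulrC mulrBr subr_gt0; apply: lt_le_trans H1.
  apply: le_lt_trans H2; apply: (le_trans (ler_norm _)).
  by rewrite !normrM !normr_sign !mul1r.
Qed.

End BestApproximation.

(** * Two-sided bounds by the interpolant *)

Section ErrorBounds.
Variable R : realType.
Local Notation mu := (@lebesgue_measure R).
Local Notation D := (`[0, +oo[%classic : set R).
Variables (a : R) (ha : 0 < a < 1) (k : nat).
Local Notation r := (rate a).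
Local Notation L := k.*2.+1.

Definition moment N (phi : R -> R) : R :=
  \int[mu]_(w in D) (w ^+ (2 * k) / growth a k N w * phi w).

(** A lower bound for x^2 / (t + x^2), with t = (scale N * w)^2, that is uniform
    in x >= a. *)
Definition damping N w : R := a ^+ 2 * ((scale a N * w) ^+ 2 + a ^+ 2)^-1.

Definition amplitude N : R :=
  4 * scale a N / pi * r ^+ N * (a / N%:R) ^+ k * (2 / (1 + a)) ^+ L.

Let a0 : 0 < a. Proof. by case/andP: ha. Qed.
Let a1 : a < 1. Proof. by case/andP: ha. Qed.

Lemma scale_gt0 N : (0 < N)%N -> 0 < scale a N.
Proof. by move=> N0; rewrite sqrtr_gt0 divr_gt0 ?ltr0n// a0. Qed.

Let den_gt0 N w x : 0 < x -> 0 < (scale a N * w) ^+ 2 + x ^+ 2.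
Proof. by move=> x0; rewrite ltr_wpDl ?sqr_ge0 ?exprn_gt0. Qed.

Let Cauchy01 N w x : 0 < x ->
  0 <= x ^+ 2 * ((scale a N * w) ^+ 2 + x ^+ 2)^-1 <= 1.
Proof.
move=> x0; have d0 := den_gt0 N w x0.
rewrite divr_ge0 ?sqr_ge0 ?(ltW d0)//= ler_pdivrMr// mul1r lerDr.
exact: sqr_ge0.
Qed.

Lemma damping01 N w : 0 <= damping N w <= 1.
Proof. exact/Cauchy01/a0. Qed.

Let continuous_Cauchy01 N x : 0 < x ->
  continuous (fun w : R => x ^+ 2 * ((scale a N * w) ^+ 2 + x ^+ 2)^-1).
Proof.
by move=> x0 w; apply: cvgM; [exact: cvg_cst|exact: continuous_Cauchy].
Qed.

Lemma moment_le N (phi psi : R -> R) : (L <= N)%N ->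
  continuous phi -> (forall w, 0 <= phi w <= 1) ->
  continuous psi -> (forall w, 0 <= psi w <= 1) ->
  (forall w, phi w <= psi w) -> moment N phi <= moment N psi.
Proof.
move=> LN cphi phi01 cpsi psi01 le; apply: le_Rintegral.
- exact: measurable_half_line.
- exact: integrable_moment_growth.
- exact: integrable_moment_growth.
- by move=> w _; rewrite ler_wpM2l// moment_growth_ge0.
Qed.

(** The remainder formula for the node polynomial.  The integral depends on x
    only through a factor that lies between damping N and 1 for x >= a, so the
    remainder has the shape of the node polynomial. *)
Lemma interpolant N : (L <= N)%N -> exists2 q : {poly R}, (size q <= N)%N &
  forall x, 0 < x -> x ^+ (2 * k) / x - q.[x ^+ 2] =
    (-1) ^+ (k + N) * (2 * scale a N / pi * r ^+ N * (a / N%:R) ^+ k)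
    * (node_poly a L N).[x ^+ 2] / x ^+ 2
    * moment N (fun w => x ^+ 2 * ((scale a N * w) ^+ 2 + x ^+ 2)^-1).
Proof.
move=> LN; have N0 : (0 < N)%N by apply: leq_trans LN.
have r0 := rate_gt0 ha.
have rN0 : r ^+ N != 0 by rewrite expf_neq0// gt_eqF.
have sN0 : (-1) ^+ N != 0 :> R by rewrite signr_eq0.
pose W := node_poly a L N.
have WE w : W.[- (scale a N * w) ^+ 2] = growth a k N w / ((-1) ^+ N * r ^+ N).
  by rewrite /growth -/W mulrAC divff ?mul1r// mulf_neq0.
have G0 w := growth_gt0 ha w LN.
have W0 w : W.[- (scale a N * w) ^+ 2] != 0.
  by rewrite WE mulf_neq0 ?(gt_eqF (G0 w))// invr_neq0// mulf_neq0.
have quotE w : ((scale a N * w) ^+ 2) ^+ k / W.[- (scale a N * w) ^+ 2] =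
    (-1) ^+ N * r ^+ N * (a / N%:R) ^+ k * (w ^+ (2 * k) / growth a k N w).
  rewrite WE scale_sqr// (exprMn _ (a / N%:R)) -exprM invf_div.
  by field; rewrite gt_eqF.
have [K HK] := moment_growth_bounded ha LN.
have c0 : 0 <= r ^+ N * (a / N%:R) ^+ k.
  apply: mulr_ge0; apply: exprn_ge0; first exact: ltW.
  by rewrite divr_ge0// ltW.
have quotK w : `|((scale a N * w) ^+ 2) ^+ k / W.[- (scale a N * w) ^+ 2]| <=
    r ^+ N * (a / N%:R) ^+ k * K.
  rewrite quotE -(mulrA ((-1) ^+ N)) -(mulrA ((-1) ^+ N)).
  rewrite normrM normr_sign mul1r normrM (ger0_norm c0) ler_wpM2l//.
  by rewrite ger0_norm ?moment_growth_ge0.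
have kN : (k < N)%N by apply: leq_trans LN; rewrite ltnS -addnn leq_addr.
have [q sq qE] := interpolation_error (scale_gt0 N0) kN (size_node_poly a L N)
  W0 quotK.
exists q => // x x0; rewrite qE//.
have -> : \int[mu]_(w in D)
    (((scale a N * w) ^+ 2) ^+ k / W.[- (scale a N * w) ^+ 2]
      * ((scale a N * w) ^+ 2 + x ^+ 2)^-1) =
    (-1) ^+ N * r ^+ N * (a / N%:R) ^+ k / x ^+ 2 *
    moment N (fun w => x ^+ 2 * ((scale a N * w) ^+ 2 + x ^+ 2)^-1).
  rewrite /moment -RintegralZl.
  - apply: eq_Rintegral => w _; rewrite quotE; field.
    by rewrite !gt_eqF// ?den_gt0.
  - exact: measurable_half_line.
  - apply: integrable_moment_growth => //; first exact: continuous_Cauchy01.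
    by move=> w; exact: Cauchy01.
rewrite exprD -/W; move: (pi) (pi_gt0 R) => p p0.
by field; rewrite !gt_eqF.
Qed.

Lemma best_error_bounds m : (1 <= k)%N -> (1 <= m)%N -> (L <= m + k)%N ->
  amplitude (m + k) * moment (m + k) (damping (m + k)) <= best_error k m a
    <= amplitude (m + k) * moment (m + k) (fun=> 1).
Proof.
move=> k1 m1; set N := (m + k)%N => LN.
have N0 : (0 < N)%N by apply: leq_trans LN.
have r0 := rate_gt0 ha; have e0 := scale_gt0 N0.
have [q sq qE] := interpolant LN.
pose B := 2 * scale a N / pi * r ^+ N * (a / N%:R) ^+ k.
have B0 : 0 < B.
  have aN0 : 0 < a / N%:R by rewrite divr_gt0 ?ltr0n ?a0.
  by rewrite /B !mulr_gt0 ?invr_gt0 ?pi_gt0 ?(exprn_gt0 _ r0) ?exprn_gt0.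
have ampE : amplitude N = B * 2 * (2 / (1 + a)) ^+ L.
  by rewrite /amplitude /B; ring.
have powE (x : R) : 0 < x -> x ^+ (2 * k) / x = x ^+ (2 * k - 1).
  move=> x0; have E : (2 * k = 2 * k - 1 + 1)%N by lia.
  by rewrite {1}E exprD [x ^+ 1]expr1 mulfK// gt_eqF.
have powL (x : R) : 0 < x -> (2 * x / (1 + a)) ^+ L / x ^+ 2 =
    (2 / (1 + a)) ^+ L * x ^+ (2 * k - 1).
  move=> x0; rewrite mulrAC (exprMn _ (2 / (1 + a))).
  have -> : L = ((2 * k - 1) + 2)%N by rewrite -mul2n; lia.
  by rewrite (exprD x) mulrA mulfK// expf_neq0// gt_eqF.
pose J (x : R) := moment N (fun w => x ^+ 2 * ((scale a N * w) ^+ 2 + x ^+ 2)^-1).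
have J0 (x : R) : 0 <= J x.
  apply: Rintegral_ge0 => w _; rewrite mulr_ge0 ?moment_growth_ge0//.
  by rewrite mulr_ge0 ?sqr_ge0// invr_ge0 addr_ge0 ?sqr_ge0.
have J_le (x : R) : 0 < x -> J x <= moment N (fun=> 1).
  move=> x0; apply: moment_le => //.
  - exact: continuous_Cauchy01.
  - by move=> w; exact: Cauchy01.
  - by move=> w; exact: cvg_cst.
  - by move=> w; rewrite ler01 lexx.
  - by move=> w; case/andP: (Cauchy01 N w x0).
have J_ge (x : R) : a <= x -> moment N (damping N) <= J x.
  move=> ax; have x0 : 0 < x by apply: lt_le_trans ax; exact: a0.
  have a0' := a0.
  apply: moment_le => //.
  - exact: continuous_Cauchy01.
  - by move=> w; exact: Cauchy01.
  - exact: continuous_Cauchy01.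
  - by move=> w; exact: Cauchy01.
  - move=> w; rewrite /damping ler_pdivrMr ?den_gt0// mulrAC ler_pdivlMr ?den_gt0//.
    have ax2 : 0 <= x ^+ 2 - a ^+ 2.
      by rewrite subr_ge0; apply: lerXn2r; rewrite ?nnegrE ?(ltW x0) ?(ltW a0).
    by have := mulr_ge0 ax2 (sqr_ge0 (scale a N * w)); lra.
have errE (x : R) : 0 < x -> x ^+ (2 * k - 1) - q.[x ^+ 2] =
    (-1) ^+ (k + N) * (B * J x * ((node_poly a L N).[x ^+ 2] / x ^+ 2)).
  by move=> x0; rewrite -powE// qE// -/B -/(J x); ring.
apply/andP; split; last first.
  apply: (@best_error_le _ a k m q) => //; first by rewrite a0 ltW ?a1.
  move=> x /andP[ax x1]; have x0 : 0 < x by apply: lt_le_trans ax; exact: a0.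
  rewrite errE// normrM normr_sign mul1r normrM ger0_norm; last first.
    by rewrite mulr_ge0 ?J0// ltW.
  apply: (@le_trans _ _ (B * moment N (fun=> 1) *
    (2 * (2 * x / (1 + a)) ^+ L / x ^+ 2))).
    apply: ler_pM => //; first by rewrite mulr_ge0 ?J0// ltW.
      by rewrite ler_wpM2l ?J_le// ltW.
    rewrite normrM normfV (ger0_norm (sqr_ge0 x)) ler_wpM2r ?invr_ge0 ?sqr_ge0//.
    by apply: node_poly_le => //; rewrite ax.
  by rewrite ampE -(mulrA 2) powL// le_eqVlt; apply/orP; left; apply/eqP; ring.
have [X [Xa XS XW]] := node_poly_alternation ha LN.
apply: (@le_best_error _ a k m q _ (k + N) X) => //; first by rewrite a0 ltW ?a1.
move=> j jN; have /andP[ax x1] := Xa _ jN.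
have x0 : 0 < X j by apply: lt_le_trans ax; exact: a0.
rewrite errE// XW//.
have s1 n : (-1) ^+ n * (-1) ^+ n = 1 :> R by rewrite -expr2 sqrr_sign.
rewrite [leRHS](_ : _ = ((-1) ^+ (k + N) * (-1) ^+ (k + N)) *
  ((-1) ^+ j * (-1) ^+ j) *
  (B * J (X j) * (2 * ((2 * X j / (1 + a)) ^+ L / X j ^+ 2)))); last by ring.
rewrite !s1 !mul1r powL// ampE.
rewrite [leLHS](_ : _ = B * moment N (damping N) *
  (2 * ((2 / (1 + a)) ^+ L * X j ^+ (2 * k - 1)))); last by ring.
have c0 : 0 <= 2 * ((2 / (1 + a)) ^+ L * X j ^+ (2 * k - 1)).
  rewrite !mulr_ge0// exprn_ge0//; last exact: ltW.
  by rewrite divr_ge0// addr_ge0// ltW ?a0.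
by rewrite (ler_wpM2r c0)// ler_wpM2l ?J_ge// ltW.
Qed.

End ErrorBounds.

(** * The limit *)

Section Limit.
Variable R : realType.

Lemma powR_half (k : nat) (x : R) : 0 < x ->
  x `^ (k%:R + 1 / 2) = x ^+ k * Num.sqrt x.
Proof.
move=> x0; rewrite powRD; last by apply/implyP => _; rewrite gt_eqF.
by rewrite powR_mulrn ?ltW// div1r powR12_sqrt ?ltW.
Qed.

Lemma cvg_inv_shift (L : nat) : (n + L.+1)%:R^-1 @[n --> \oo] --> (0 : R).
Proof.
apply/gtr0_cvgV0; first by apply: nearW => n; rewrite addnS ltr0n.
have := @cvgr_idn R; rewrite -(cvg_shiftn L.+1) => H; exact: H.
Qed.

Variables (a : R) (ha : 0 < a < 1) (k : nat).
Local Notation r := (rate a).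
Local Notation L := k.*2.+1.

Definition normalization m : R :=
  ((1 + a) / (1 - a)) `^ (m%:R - 1 / 2) * (2 * m%:R - 1) `^ (k%:R + 1 / 2).

Lemma damping_cvg (w : R) : damping a (n + L) w @[n --> \oo] --> (1 : R).
Proof.
have /andP[a0 a1] := ha.
have -> : (1 : R) = a ^+ 2 * (0 + a ^+ 2)^-1.
  by rewrite add0r divff// expf_neq0// gt_eqF.
apply: cvgM; first exact: cvg_cst.
apply: cvgV; first by rewrite add0r expf_neq0// gt_eqF.
apply: cvgD; last exact: cvg_cst.
under eq_fun do rewrite scale_sqr//.
rewrite -(mul0r (w ^+ 2)) -(mulr0 a).
apply: cvgM; last exact: cvg_cst.
by apply: cvgM; [exact: cvg_cst|exact: cvg_inv_shift].
Qed.

(** With m = n + k + 1 and N = m + k the powers of r combine to r^(k + 1/2) and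
    the rest to a power of a (2 m - 1) / N = a (2 - L / N). *)
Lemma amplitude_normalization n :
  amplitude a k (n + L) * normalization (n + k.+1) =
  4 / pi * (2 / (1 + a)) ^+ L * (r ^+ k * Num.sqrt r) *
  ((a * (2 - L%:R / (n + L)%:R)) ^+ k * Num.sqrt (a * (2 - L%:R / (n + L)%:R))).
Proof.
have /andP[a0 a1] := ha; have r0 := rate_gt0 ha.
set m := (n + k.+1)%N; set N := (n + L)%N.
have NE : N = (m + k)%N by rewrite /N /m -addnn; lia.
have N0 : 0 < N%:R :> R by rewrite ltr0n /N addnS.
have mE : 2 * m%:R - 1 = N%:R * (2 - L%:R / N%:R) :> R.
  rewrite mulrBr mulrCA divff ?gt_eqF// mulr1 NE natrD -addnn -natr1 natrD.
  by ring.
have m0 : 0 < 2 * m%:R - 1 :> R.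
  have : 1 <= m%:R :> R by rewrite ler1n /m addnS.
  by lra.
have d0 : 0 < 2 - L%:R / N%:R :> R.
  by rewrite -(pmulr_rgt0 _ N0) -mE.
have rm : r ^+ N * ((1 + a) / (1 - a)) `^ (m%:R - 1 / 2) = r ^+ k * Num.sqrt r.
  have -> : (1 + a) / (1 - a) = r^-1 by rewrite /rate invf_div.
  have rV0 : 0 < r^-1 by rewrite invr_gt0.
  rewrite powRD; last by apply/implyP => _; rewrite gt_eqF.
  rewrite powRN powR_mulrn ?(ltW rV0)// div1r powR12_sqrt ?(ltW rV0)//.
  rewrite sqrtrV ?(ltW r0)// invrK NE addnC exprD exprVn -mulrA.
  by congr (_ * _); rewrite mulrA divff ?mul1r// expf_neq0// gt_eqF.
rewrite -rm /amplitude /normalization powR_half// mE.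
rewrite (expr_div_n a) (exprMn _ N%:R) (exprMn _ a) !sqrtrM ?(ltW a0) ?(ltW N0)//.
rewrite /scale sqrtrM ?(ltW a0)// sqrtrV ?(ltW N0)//.
have sN : Num.sqrt N%:R != 0 :> R by rewrite gt_eqF// sqrtr_gt0.
have Nk : N%:R ^+ k != 0 :> R by rewrite expf_neq0// gt_eqF.
move: (pi) (pi_gt0 R) => p p0.
move: (r ^+ N) (_ `^ (m%:R - 1 / 2)) (2 / (1 + a)) => u1 u2 u3.
move: (Num.sqrt N%:R) sN (N%:R ^+ k) Nk => u4 u40 u5 u50.
move: (Num.sqrt (2 - _)) ((2 - _) ^+ k) => u6 u7.
by field; rewrite gt_eqF// u40 u50.
Qed.

Lemma amplitude_normalization_cvg :
  amplitude a k (n + L) * normalization (n + k.+1) @[n --> \oo] -->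
  4 / pi * (2 / (1 + a)) ^+ L * (r ^+ k * Num.sqrt r) *
  ((2 * a) ^+ k * Num.sqrt (2 * a)).
Proof.
under eq_fun do rewrite amplitude_normalization.
apply: cvgM; first exact: cvg_cst.
have base : a * (2 - L%:R / (n + L)%:R) @[n --> \oo] --> 2 * a.
  rewrite (_ : 2 * a = a * (2 - L%:R * 0)); last by rewrite mulr0 subr0 mulrC.
  apply: cvgM; first exact: cvg_cst.
  apply: cvgB; first exact: cvg_cst.
  by apply: cvgM; [exact: cvg_cst|exact: cvg_inv_shift].
apply: cvgM.
  exact: (continuous_cvg _ (@exprn_continuous _ k _) base).
exact: (continuous_cvg _ (@sqrt_continuous _ _) base).
Qed.

(** With c = (1 + a) / (2 a), the quotient of 2 / (1 + a) by 1 - r^2, both sides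
    reduce to 2 G / pi times (c^2 r (2 a))^(k + 1/2). *)
Lemma limit_constant G :
  4 / pi * (2 / (1 + a)) ^+ L * (r ^+ k * Num.sqrt r) *
  ((2 * a) ^+ k * Num.sqrt (2 * a)) * (G / 2 / (1 - r ^+ 2) ^+ L) =
  2 / pi * ((1 - a ^+ 2) / (2 * a)) `^ (k%:R + 1 / 2) * G.
Proof.
have /andP[a0 a1] := ha; have r0 := rate_gt0 ha.
have b0 := one_sub_rate_sqr_gt0 ha.
have D0 : 0 < 1 - a ^+ 2 by nra.
have an0 : a != 0 by rewrite gt_eqF.
have bn0 : 1 + a != 0 by rewrite gt_eqF// addr_gt0.
pose c : R := (1 + a) / (2 * a).
have c0 : 0 < c by apply: divr_gt0; lra.
have cE : (2 / (1 + a)) ^+ L / (1 - r ^+ 2) ^+ L = c ^+ L.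
  rewrite -expr_div_n (one_sub_rate_sqr ha) /c; congr (_ ^+ _).
  by field; rewrite ?an0 ?bn0.
have bE : (1 - a ^+ 2) / (2 * a) = c ^+ 2 * r * (2 * a).
  by rewrite /c /rate; field; rewrite ?an0 ?bn0.
have a20 : 0 < 2 * a by rewrite mulr_gt0.
have c20 : 0 < c ^+ 2 by rewrite exprn_gt0.
have cr0 : 0 < c ^+ 2 * r by exact: mulr_gt0.
rewrite bE (powR_half _ (mulr_gt0 cr0 a20)).
rewrite (exprMn _ (c ^+ 2 * r)) (exprMn _ (c ^+ 2)) -exprM.
rewrite (sqrtrM (2 * a) (ltW cr0)) (sqrtrM r (ltW c20)) sqrtr_sqr (gtr0_norm c0).
have cL : c ^+ L = c ^+ (2 * k) * c by rewrite -exprSr mul2n.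
rewrite cL in cE.
transitivity (2 / pi * G * ((2 / (1 + a)) ^+ L / (1 - r ^+ 2) ^+ L) *
  (r ^+ k * Num.sqrt r) * ((2 * a) ^+ k * Num.sqrt (2 * a))).
  move: (pi) (pi_gt0 R) => p p0.
  by field; rewrite expf_neq0 ?gt_eqF.
by rewrite cE; ring.
Qed.

End Limit.

Theorem mainTheorem1 (R : realType) (a : R) (ha : 0 < a < 1)
    (k : nat) (hk : (1 <= k)%N) :
  (fun m : nat =>
     best_error k m a * ((1 + a) / (1 - a)) `^ (m%:R - 1 / 2)
       * (2 * m%:R - 1) `^ (k%:R + 1 / 2)) @ \oo
  --> 2 / pi * ((1 - a ^+ 2) / (2 * a)) `^ (k%:R + 1 / 2)
       * Gamma (k%:R + 1 / 2).
Proof.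
rewrite -(limit_constant ha) -(cvg_shiftn k.+1) /=.
pose L := k.*2.+1.
have E n : (n + k.+1 + k)%N = (n + L)%N by rewrite /L -addnn; lia.
have norm0 n : 0 <= normalization a k (n + k.+1).
  by rewrite mulr_ge0 ?powR_ge0.
have amp := @amplitude_normalization_cvg R a ha k.
apply: (@squeeze_cvgr _ _ _ _
  (fun n => amplitude a k (n + L) * normalization a k (n + k.+1)
     * moment a k (n + L) (damping a (n + L)))
  (fun n => amplitude a k (n + L) * normalization a k (n + k.+1)
     * moment a k (n + L) (fun=> 1))).
- near=> n; have m1 : (1 <= n + k.+1)%N by rewrite addnS.
  have LN : (k.*2.+1 <= n + k.+1 + k)%N by rewrite E leq_addl.
  have := best_error_bounds ha hk m1 LN; rewrite E => /andP[lo hi].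
  rewrite -(mulrA (best_error _ _ _)) -/(normalization a k (n + k.+1)).
  by apply/andP; split; [rewrite mulrAC ler_wpM2r|rewrite [leRHS]mulrAC ler_wpM2r].
- apply: cvgM; first exact: amp.
  apply: integral_moment_growth_cvg => //.
  + move=> n w; apply: cvgM; first exact: cvg_cst.
    by apply: continuous_Cauchy; case/andP: ha.
  + by move=> n w; apply: damping01.
  + exact: damping_cvg.
- apply: cvgM; first exact: amp.
  apply: integral_moment_growth_cvg => //.
  + by move=> n w; exact: cvg_cst.
  + by move=> n w; rewrite ler01 lexx.
  + by move=> w; exact: cvg_cst.
Unshelve. all: by end_near. Qed.
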